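(* Let $K\subset\mathbb{R}^2$ be a convex body and write $\lambda_i^\star=\lambda_i(\mathrm{cs}(K)^\star)$ for $i=1,2$. Then $$\mathrm{vol}(K)\ \ge\ \frac{3}{2}\,\lambda_1^\star\,\lambda_2^\star+\frac12\,\lambda_1^\star\,\big(\lambda_2^\star-\lambda_1^\star\big),$$ and equality holds if and only if $K$ is, up to translations and unimodular transformations, equal to a triangle $$T_{s,t}=\mathrm{conv}\{(-s,t-s),\,(s,t),\,(0,-t)\}$$ for some real numbers $t\ge s>0$.
   Context: A convex body in $\mathbb{R}^n$ is a compact convex set with non-empty interior; $\mathrm{vol}$ is $n$-dimensional Lebesgue measure. The central symmetral of $K$ is $\mathrm{cs}(K)=\frac12(K-K)=\{\frac12(x-y):x,y\in K\}$; it is origin-symmetric with the origin in its interior. The polar body of $L$ is $L^\star=\{y\in\mathbb{R}^n:\langle x,y\rangle\le 1\text{ for all }x\in L\}$. For a convex body $L$ with the origin in its interior, the $i$-th successive minimum $\lambda_i(L)$, $1\le i\le n$, is the smallest $\lambda>0$ such that $\lambda L$ contains $i$ linearly independent points of $\mathbb{Z}^n$. A unimodular transformation is a linear map $x\mapsto Ux$ with $U\in\mathrm{GL}_n(\mathbb{Z})$ (integer matrix with determinant $\pm1$). *)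

(* Defs.v *)
From HB Require Import structures.
From mathcomp Require Export all_boot all_order all_algebra.
From mathcomp Require Export all_classical all_reals all_analysis.
Export Order.TTheory GRing.Theory Num.Theory numFieldNormedType.Exports.

Set Implicit Arguments.
Unset Strict Implicit.
Unset Printing Implicit Defensive.

Local Open Scope classical_set_scope.
Local Open Scope ring_scope.

Definition convex_body (R : realType) (n : nat) (K : set 'cV[R]_n) : Prop :=
  [/\ compact K, convex_set K & K° !=set0].

Definition central_symmetral (R : realType) (n : nat) (K : set 'cV[R]_n) :
    set 'cV[R]_n :=
  [set 2^-1 *: (x - y) | x in K & y in K].

Definition dotcv (R : realType) (n : nat) (x y : 'cV[R]_n) : R :=
  \sum_(i < n) x i 0 * y i 0.

Definition polar (R : realType) (n : nat) (L : set 'cV[R]_n) : set 'cV[R]_n :=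
  [set y | forall x, L x -> dotcv x y <= 1].

Definition lattice_dilates (R : realType) (n i : nat) (L : set 'cV[R]_n) :
    set R :=
  [set l | 0 < l /\
    exists z : i.-tuple 'cV[int]_n,
      free (map (map_mx (intr : int -> R)) z) /\
      forall j : 'I_i,
        [set l *: x | x in L] (map_mx (intr : int -> R) (tnth z j))].

(* The default value 0 is only returned when there is no smallest dilate;
   it exists for 1 <= i <= n when L is compact with 0 in its interior. *)
Definition successive_minimum (R : realType) (n i : nat) (L : set 'cV[R]_n) :
    R :=
  xget 0 [set l | lattice_dilates i L l /\ lbound (lattice_dilates i L) l].

Definition col2 (R : realType) (x y : R) : 'cV[R]_2 :=
  \col_(i < 2) [:: x; y]`_i.

(* The product measure lives on R * R, hence the preimage. *)
Definition vol2 (R : realType) (K : set 'cV[R]_2) : \bar R :=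
  (@lebesgue_measure R \x @lebesgue_measure R)%E
    [set p : R * R | K (col2 p.1 p.2)].

Definition convex_hull (R : realType) (n : nat) (A : set 'cV[R]_n) : set 'cV[R]_n :=
  smallest (@convex_set R 'cV[R]_n) A.

Definition triangle (R : realType) (s t : R) : set 'cV[R]_2 :=
  convex_hull [set x | x = col2 (- s) (t - s) \/ x = col2 s t \/ x = col2 0 (- t)].

Definition unimodular_translate (R : realType) (n : nat) (K L : set 'cV[R]_n) :
    Prop :=
  exists (U : 'M[int]_n) (v : 'cV[R]_n),
    U \in unitmx /\ K = [set map_mx (intr : int -> R) U *m x + v | x in L].

(* Main.v *)
(* Write w(z) for the width of K in direction z, so that h_{cs K}(z) = w(z) / 2 and
   the successive minima of the polar body are half the first two minima of the norm w
   on Z^2.  In dimension 2 these are attained at a basis z1, z2 of Z^2 with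
   w(z1) <= w(z2) <= w(z2 + k z1) for all integers k.  In the coordinates given by that
   basis, K is inscribed in a box [-s, s] x [-t, t] with s <= t, and its widths in the
   directions x - y and x + y are at least 2t.  K touches the left, right, bottom and top
   sides at A = (-s, a), B = (s, b), C = (c, -t), D = (d, t); the quadrilateral ACBD has
   area 2st - (b - a)(d - c) / 2.  If (b - a)(d - c) <= 0 this is more than enough.
   Otherwise reflect so that both factors are positive, and let E, F be the points of K
   where x - y is largest and smallest.  Bounding the corner triangles CEB and DFA from
   below shows that the hexagon ACEBDF has area at least 2st - s^2 / 2, with equality only
   if it is one of the triangles T_{s,t}, -T_{s,t}; a point of K outside that triangle
   would increase the area. *)
Require Import Defs.
From mathcomp Require Import measurable_realfun.
From mathcomp Require Import ring lra zify.
Set Implicit Arguments.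
Unset Strict Implicit.
Unset Printing Implicit Defensive.
Local Open Scope classical_set_scope.
Local Open Scope ring_scope.

(** * Area under affine maps *)

Section area.
Variable R : realType.
Notation mu := (@lebesgue_measure R).
Notation mR := (measurableTypeR R).

Definition area (S : set (R * R)) : \bar R := (mu \x mu)%E S.

Definition pmeasurable (S : set (R * R)) : Prop := @measurable _ (mR * mR)%type S.

(** As a function of [A] the left-hand side is a measure giving every half-open interval its length,
    so uniqueness of Lebesgue measure applies. For negative [m] the preimage is half-open at the
    other end, which leaves the length unchanged. *)
Lemma lebesgue_measure_affine (k m : R) (A : set mR) : m != 0 ->
  measurable A ->
  (`|m|%:E * mu ((fun y : R => k + m * y)%R @^-1` A))%E = mu A.
Proof.
move=> m0 mA.
pose f : mR -> mR := fun y => k + m * y.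
have mf : measurable_fun [set: mR] f.
  by apply: continuous_measurable_fun => x; apply: cvgD; [exact: cvg_cst|apply: cvgM;
    [exact: cvg_cst|exact: cvg_id]].
have m_gt0 : 0 < `|m| by rewrite normr_gt0.
pose nu := mscale (NngNum (ltW m_gt0))
  (measure_function_pushforward__canonical__measure_function_Measure mu mf).
apply/esym; apply: (@lebesgue_measure_unique R nu) => //= _ [[a b]] _ <-.
rewrite -[RHS]/(`|m|%:E * mu (f @^-1` `]a, b]))%E.
have [mp|mn|m0'] := ltgtP 0 m; last by rewrite -m0' eqxx in m0.
- have -> : f @^-1` `]a, b] = `](a - k) / m, (b - k) / m]%classic.
    apply/seteqP; split=> y /=;
      rewrite !in_itv/= /f ltr_pdivrMr// ler_pdivlMr// ltrBlDl lerBrDl mulrC//.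
  rewrite gtr0_norm// !lebesgue_measure_itv/= !lte_fin ltr_pM2r ?invr_gt0// ltrD2r.
  case: ifP => _; last by rewrite mule0.
  by rewrite -!EFinD -EFinM; congr (_%:E); field; rewrite m0.
- have -> : f @^-1` `]a, b] = `[(b - k) / m, (a - k) / m[%classic.
    apply/seteqP; split=> y /=;
      rewrite !in_itv/= /f andbC ltr_ndivlMr// ler_ndivrMr// ltrBlDl lerBrDl mulrC//.
  rewrite ltr0_norm// !lebesgue_measure_itv/= !lte_fin ltr_nM2r ?invr_lt0// ltrD2r.
  case: ifP => _; last by rewrite mule0.
  by rewrite -!EFinD -EFinM; congr (_%:E); field; rewrite m0.
Qed.

Lemma measurable_affine2 (a b c d e f : R) :
  measurable_fun [set: mR * mR]
   ((fun p => (a * p.1 + b * p.2 + e, c * p.1 + d * p.2 + f)) : mR * mR -> mR * mR).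
Proof.
have m1 := @measurable_fst _ _ mR mR.
have m2 := @measurable_snd _ _ mR mR.
by apply: measurable_fun_pair;
  (apply: measurable_funD; [apply: measurable_funD; apply: measurable_funM|]).
Qed.

Lemma pmeasurable_affine (a b c d e f : R) (S : set (R * R)) : pmeasurable S ->
  pmeasurable [set p | S (a * p.1 + b * p.2 + e, c * p.1 + d * p.2 + f)].
Proof.
by move=> mS; have := @measurable_affine2 a b c d e f measurableT S mS; rewrite setTI.
Qed.

(** The pushforward under the swap agrees with the product measure on rectangles, which determine
    it. *)
Lemma area_swap (S : set (R * R)) : pmeasurable S ->
  area [set p | S (p.2, p.1)] = area S.
Proof.
move=> mS.
pose f : mR * mR -> mR * mR := fun p => (p.2, p.1).
have mf : measurable_fun [set: mR * mR] f by exact: measurable_fun_pair.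
rewrite -[LHS]/(pushforward (mu \x mu)%E f S).
apply/esym/product_measure_unique => //= A B mA mB; rewrite /pushforward.
have -> : f @^-1` (A `*` B) = B `*` A by apply/seteqP; split=> p [].
by rewrite product_measure1E// muleC.
Qed.

(** Fubini: on each vertical fibre the map is affine of slope [m], so the one-dimensional statement
    can be integrated over the first coordinate. *)
Lemma area_lower (k m c : R) (S : set (R * R)) : m != 0 -> pmeasurable S ->
  (`|m|%:E * area [set p | S (p.1, k * p.1 + c + m * p.2)%R])%E = area S.
Proof.
move=> m0 mS.
pose S' := [set p : mR * mR | S (p.1, k * p.1 + c + m * p.2)].
have mS' : pmeasurable S'.
  have := pmeasurable_affine 1 0 k m 0 c mS; congr pmeasurable; apply/seteqP.
  by split=> p /=; rewrite mul1r mul0r !addr0 addrAC.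
rewrite -[area _]/((mu \x mu)%E S') /product_measure1 -ge0_integralZl//;
  last exact: measurable_fun_xsection.
apply: eq_integral => x _ /=.
rewrite -[RHS](lebesgue_measure_affine (k * x + c) m0); last exact: measurable_xsection.
congr (_ * mu _)%E; apply/seteqP; split=> y /=; rewrite /xsection /= !inE //.
Qed.

(** For nonzero [b] the map is a composition of a map as in [area_lower], the swap of coordinates,
    and another map as in [area_lower]. If [b] is zero, then [a] is not, and swapping the two
    variables leads back to the first case. *)
Lemma area_affine (a b c d e f : R) (S : set (R * R)) :
  a * d - b * c != 0 -> pmeasurable S ->
  (`|(a * d - b * c)%R|%:E *
   area [set p | S (a * p.1 + b * p.2 + e, c * p.1 + d * p.2 + f)%R])%E = area S.
Proof.
have main (a' b' c' d' : R) (T : set (R * R)) : a' * d' - b' * c' != 0 -> b' != 0 ->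
  pmeasurable T ->
  (`|(a' * d' - b' * c')%R|%:E *
   area [set p | T (a' * p.1 + b' * p.2 + e, c' * p.1 + d' * p.2 + f)%R])%E = area T.
  move=> D0 b0 mT; pose m := (c' * b' - a' * d') / b'.
  have m0 : m != 0.
    by rewrite mulf_neq0 ?invr_neq0// -oppr_eq0 opprB [c' * b']mulrC.
  pose T2 := [set p | T (p.1, d' / b' * p.1 + (f - d' * e / b') + m * p.2)].
  have mT2 : pmeasurable T2.
    have := pmeasurable_affine 1 0 (d' / b') m 0 (f - d' * e / b') mT; congr pmeasurable.
    by apply/seteqP; split=> p /=; rewrite mul1r mul0r !addr0 addrAC.
  have mT1 : pmeasurable [set p | T2 (p.2, p.1)].
    have := pmeasurable_affine 0 1 1 0 0 0 mT2; congr pmeasurable.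
    by apply/seteqP; split=> p /=; rewrite !mul1r !mul0r !addr0 add0r.
  rewrite -(area_lower (d' / b') (f - d' * e / b') m0 mT) -/T2 -(area_swap mT2).
  rewrite -(area_lower a' e b0 mT1) muleA -EFinM -normrM.
  have -> : `|m * b'| = `|a' * d' - b' * c'|.
    by rewrite /m divfK// -normrN opprB [c' * b']mulrC.
  congr (_ * area _)%E; apply: eq_set => -[x y] /=.
  have -> : a' * x + e + b' * y = a' * x + b' * y + e by ring.
  by congr (T (_, _)); rewrite /m /=; field.
move=> D0 mS; have [b0|] := eqVneq b 0; last by move=> ?; exact: main.
have ad0 : a * d != 0 by rewrite b0 mul0r subr0 in D0.
have a0 : a != 0 by apply: contra_neq ad0 => ->; rewrite mul0r.
have D0' : b * c - a * d != 0 by rewrite -oppr_eq0 opprB.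
rewrite -[RHS](main b a d c S D0' a0 mS) -normrN opprB; congr (_ * _)%E.
rewrite -area_swap; last exact: pmeasurable_affine.
by congr area; apply: eq_set => p /=; rewrite [b * _ + _]addrC [d * _ + _]addrC.
Qed.
End area.

(** * Triangles *)

Section triangles.
Variable R : realType.
Notation mu := (@lebesgue_measure R).
Notation mR := (measurableTypeR R).
Implicit Types (P Q S G : R * R) (A B : set (R * R)).

Lemma area_le A B : pmeasurable A -> pmeasurable B -> A `<=` B -> (area A <= area B)%E.
Proof. by move=> mA mB AB; apply: le_measure; rewrite ?inE. Qed.

Lemma area_U A B : pmeasurable A -> pmeasurable B -> A `&` B = set0 ->
  area (A `|` B) = (area A + area B)%E.
Proof. by move=> mA mB AB; apply: measureU. Qed.

Lemma area_U_le A B : pmeasurable A -> pmeasurable B -> (area (A `|` B) <= area A + area B)%E.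
Proof. by move=> mA mB; apply: measureU2. Qed.

Lemma area0 : area (@set0 (R * R)) = 0%E.
Proof. exact: measure0. Qed.

Lemma area_X (I J : interval R) :
  area ([set` I] `*` [set` J]) = (mu [set` I] * mu [set` J])%E.
Proof. by apply: product_measure1E; exact: measurable_itv. Qed.

Lemma pmeasurable_halfplane (a b c : R) : pmeasurable [set p | 0 < a * p.1 + b * p.2 + c].
Proof.
have mS : pmeasurable (`]0, +oo[%classic `*` [set: R]) by exact: measurableX.
have := pmeasurable_affine a b 0 0 c 0 mS; congr pmeasurable; apply: eq_set => p /=.
by rewrite in_itv/= andbT; apply/propext; split=> [[]|].
Qed.

Lemma pmeasurableI A B : pmeasurable A -> pmeasurable B -> pmeasurable (A `&` B).
Proof. exact: measurableI. Qed.

Lemma pmeasurableU A B : pmeasurable A -> pmeasurable B -> pmeasurable (A `|` B).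
Proof. exact: measurableU. Qed.

Lemma pmeasurableC A : pmeasurable A -> pmeasurable (~` A).
Proof. exact: measurableC. Qed.

Lemma pmeasurable_line (a b c : R) : pmeasurable [set p | a * p.1 + b * p.2 + c = 0].
Proof.
have := pmeasurableI (pmeasurableC (pmeasurable_halfplane a b c)) (pmeasurableC (pmeasurable_halfplane (- a) (- b) (- c))).
congr pmeasurable; apply/seteqP; split => p /=; last by move=> h; split; nra.
by move=> [] /negP h1 /negP h2; nra.
Qed.

(** A similarity with linear part of rows (a, b) and (-b, a) carries the line to {0} x R, a
    rectangle with a side of length zero. *)
Lemma area_line (a b c : R) : (a != 0) || (b != 0) ->
  area [set p | a * p.1 + b * p.2 + c = 0] = 0%E.
Proof.
move=> ab0.
have D0 : a * a - b * (- b) != 0.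
  by rewrite mulrN opprK -!expr2 paddr_eq0 ?sqr_ge0// !sqrf_eq0 negb_and.
have mS : pmeasurable ([set` `[0, 0]] `*` [set` `]-oo, +oo[] : set (R * R)).
  by apply: measurableX; exact: measurable_itv.
have := area_affine c 0 D0 mS; rewrite area_X !lebesgue_measure_itv /= ltxx mul0e.
move/eqP; rewrite mule_eq0 eqe normr_eq0 (negbTE D0)/= => /eqP <-.
congr area; apply: eq_set => p /=; rewrite !in_itv/=; apply/propext; split.
  by move=> ->; rewrite lexx.
by move=> [/le_anti <-].
Qed.

(** Twice the signed area of the triangle PQG, positive exactly when G lies to the left of the
    directed line PQ. *)
Definition cross P Q G := (Q.1 - P.1) * (G.2 - P.2) - (Q.2 - P.2) * (G.1 - P.1).

(** The vertices are meant counterclockwise; in the other orientation the set is empty. *)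
Definition open_triangle P Q S : set (R * R) :=
  [set G | [/\ 0 < cross P Q G, 0 < cross Q S G & 0 < cross S P G]].

Definition closed_triangle P Q S : set (R * R) :=
  [set G | [/\ 0 <= cross P Q G, 0 <= cross Q S G & 0 <= cross S P G]].

Lemma crossE P Q G :
  cross P Q G = (P.2 - Q.2) * G.1 + (Q.1 - P.1) * G.2 + (P.1 * Q.2 - P.2 * Q.1).
Proof. by rewrite /cross; ring. Qed.

Lemma pmeasurable_cross P Q : pmeasurable [set G | 0 < cross P Q G].
Proof.
have := pmeasurable_halfplane (P.2 - Q.2) (Q.1 - P.1) (P.1 * Q.2 - P.2 * Q.1).
by congr pmeasurable; apply: eq_set => p; rewrite crossE.
Qed.

Lemma pmeasurable_open_triangle P Q S : pmeasurable (open_triangle P Q S).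
Proof.
have := pmeasurableI (pmeasurable_cross P Q) (pmeasurableI (pmeasurable_cross Q S) (pmeasurable_cross S P)).
by congr pmeasurable; apply/seteqP; split=> G /= => [[? []]|[]].
Qed.

Lemma pmeasurable_closed_triangle P Q S : pmeasurable (closed_triangle P Q S).
Proof.
have := pmeasurableI (pmeasurableC (pmeasurable_cross Q P)) (pmeasurableI (pmeasurableC (pmeasurable_cross S Q)) (pmeasurableC (pmeasurable_cross P S))).
have N U V G : (~ 0 < cross U V G) = (0 <= cross V U G).
  have -> : cross V U G = - cross U V G by rewrite /cross; ring.
  by apply/propext; rewrite oppr_ge0 leNgt; split=> /negP.
congr pmeasurable; apply/seteqP; split=> G /=; rewrite !N; first by move=> [? []].
by move=> [].
Qed.

(** The corner [T] and its image [T'] under the half-turn about the centre of the square of side D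
    are disjoint, have equal area, and fill the square up to its diagonal, which has area zero. *)
Lemma area_corner (D : R) : 0 < D ->
  area [set p : R * R | [/\ 0 < p.1, 0 < p.2 & p.1 + p.2 < D]] =
  (D ^+ 2 / 2)%:E.
Proof.
move=> D0; set T := [set _ | _].
pose H := [set p : R * R | p.1 + p.2 < D].
have mH : pmeasurable H.
  have := pmeasurable_halfplane (-1) (-1) D; congr pmeasurable; apply: eq_set => p /=.
  by rewrite !mulN1r addrC -opprD subr_gt0.
have mQ : pmeasurable ([set` `]0, D[] `*` [set` `]0, D[]).
  by apply: measurableX; exact: measurable_itv.
have TE : T = ([set` `]0, D[] `*` [set` `]0, D[]) `&` H.
  apply/seteqP; split=> p; rewrite /T /H /= !in_itv /=.
    by move=> [h1 h2 h3]; rewrite h1 h2; split => //; split; lra.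
  by move=> [[/andP[h1 _] /andP[h2 _]] h3].
have mT : pmeasurable T by rewrite TE; exact: pmeasurableI.
pose T' := [set p : R * R | T (D - p.1, D - p.2)].
have T'E : T' = [set p : R * R | T (-1 * p.1 + 0 * p.2 + D, 0 * p.1 + -1 * p.2 + D)].
  by apply: eq_set => p /=; congr (T (_, _)); ring.
have mT' : pmeasurable T' by rewrite T'E; exact: pmeasurable_affine.
have aT' : area T' = area T.
  have D1 : (-1) * (-1) - 0 * 0 != 0 :> R by rewrite mulr0 subr0 mulrNN mulr1 oner_neq0.
  rewrite -[RHS](area_affine D D D1 mT) -T'E.
  by rewrite mulr0 subr0 mulrNN mulr1 normr1 mul1e.
pose L := [set p : R * R | 1 * p.1 + 1 * p.2 + (- D) = 0].
have mL : pmeasurable L by exact: pmeasurable_line.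
have aQ : area ([set` `]0, D[] `*` [set` `]0, D[]) = (D ^+ 2)%:E.
  by rewrite area_X !lebesgue_measure_itv /= lte_fin D0 -EFinB subr0 -EFinM.
have aTT' : area (T `|` T') = (area T + area T)%E.
  rewrite area_U ?aT'//; apply/seteqP; split=> p //; rewrite /T' /T /=.
  by move=> [[h1 h2 h3] [h4 h5 h6]]; lra.
have le1 : (area T + area T <= (D ^+ 2)%:E)%E.
  rewrite -aTT' -aQ; apply: area_le => //; first exact: pmeasurableU.
  by move=> p; rewrite /T' /T /= !in_itv /= => -[[h1 h2 h3]|[h1 h2 h3]];
    split; apply/andP; split; lra.
have le2 : ((D ^+ 2)%:E <= area T + area T)%E.
  rewrite -aTT' -aQ -[leRHS]adde0 -(@area_line 1 1 (- D)) ?oner_neq0// -/L.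
  apply: le_trans (area_U_le _ _) => //; last exact: pmeasurableU.
  apply: area_le => //; first by apply: pmeasurableU => //; exact: pmeasurableU.
  move=> p; rewrite /T' /T /L /= !in_itv /= => -[/andP[h1 h2] /andP[h3 h4]].
  by have [h|h|h] := ltgtP (p.1 + p.2) D; [left; left|left; right|right]; try split; lra.
have : (area T + area T = (D ^+ 2)%:E)%E by apply/le_anti; rewrite le1 le2.
have : (0 <= area T)%E by exact: measure_ge0.
case: (area T) => [r| |] //= r0 /eqP; rewrite -EFinD eqe => /eqP h; congr (_%:E).
by apply/esym; rewrite -h; field.
Qed.

(** The affine map from G to (cross S P G, cross P Q G) has determinant D = cross P Q S. Since the
    three crosses add up to D, it pulls the corner with legs D back to the triangle, so D times the
    area is D^2 / 2. A degenerate triangle is empty. *)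
Lemma area_open_triangle P Q S : 0 <= cross P Q S ->
  area (open_triangle P Q S) = (cross P Q S / 2)%:E.
Proof.
have sumE G : cross P Q S = cross P Q G + cross Q S G + cross S P G by rewrite /cross; ring.
rewrite le_eqVlt => /orP[/eqP D0|D0].
  rewrite -D0 mul0r (_ : open_triangle P Q S = set0) ?area0//.
  apply/seteqP; split=> // G [h1 h2 h3]; have := sumE G; rewrite -D0; lra.
set D := cross P Q S in D0 *.
have mT : pmeasurable [set p : R * R | [/\ 0 < p.1, 0 < p.2 & p.1 + p.2 < D]].
  have := pmeasurableI (pmeasurableI (pmeasurable_halfplane 1 0 0) (pmeasurable_halfplane 0 1 0)) (pmeasurable_halfplane (-1) (-1) D).
  congr pmeasurable; apply: eq_set => p /=; apply/propext.
  have -> : -1 * p.1 + -1 * p.2 + D = D - (p.1 + p.2) by ring.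
  by rewrite !mul0r !mul1r !addr0 add0r subr_gt0; split=> [[[]]|[]].
have DE : (S.2 - P.2) * (Q.1 - P.1) - (P.1 - S.1) * (P.2 - Q.2) = D.
  by rewrite /D /cross; ring.
have := @area_affine _ (S.2 - P.2) (P.1 - S.1) (P.2 - Q.2) (Q.1 - P.1)
  (S.1 * P.2 - S.2 * P.1) (P.1 * Q.2 - P.2 * Q.1) _ _ mT.
rewrite DE area_corner// gtr0_norm// gt_eqF// => /(_ isT).
set T := [set _ | _]; have <- : open_triangle P Q S = T.
  apply/seteqP; rewrite /T; split=> G /=; rewrite -!crossE => -[h1 h2 h3];
  by have := sumE G; rewrite -/D; split => //; lra.
have : (0 <= area (open_triangle P Q S))%E by exact: measure_ge0.
case: (area _) => [r| |] //= r0 => [/eqP|/eqP]; last by rewrite gt0_muley ?lte_fin.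
rewrite -EFinM eqe => /eqP h; congr (_%:E); apply: (mulfI (lt0r_neq0 D0)).
by rewrite h; field.
Qed.

(** The closed triangle exceeds the open one only by points on three lines, each of area zero. *)
Lemma area_closed_triangle P Q S : 0 < cross P Q S ->
  area (closed_triangle P Q S) = (cross P Q S / 2)%:E.
Proof.
move=> D0; apply/le_anti/andP; split; last first.
  rewrite -(area_open_triangle (ltW D0)); apply: area_le;
    [exact: pmeasurable_open_triangle|exact: pmeasurable_closed_triangle|].
  by move=> G [h1 h2 h3]; split; exact: ltW.
pose L U V := [set p : R * R | (U.2 - V.2) * p.1 + (V.1 - U.1) * p.2 + (U.1 * V.2 - U.2 * V.1) = 0].
have mL U V : pmeasurable (L U V) by exact: pmeasurable_line.
have aL U V W : 0 < cross U V W -> area (L U V) = 0%E.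
  move=> h; rewrite area_line//; apply/orP; rewrite !subr_eq0.
  have [e1|] := eqVneq U.2 V.2; last by left.
  by right; apply: contraTN h => /eqP e2; rewrite /cross e1 e2 !subrr !mul0r subrr ltxx.
have mU3 : pmeasurable (open_triangle P Q S `|` L P Q `|` L Q S `|` L S P).
  by apply: pmeasurableU => //; apply: pmeasurableU => //; apply: pmeasurableU => //;
    exact: pmeasurable_open_triangle.
apply: (@le_trans _ _ (area (open_triangle P Q S `|` L P Q `|` L Q S `|` L S P))).
  apply: area_le => //; first exact: pmeasurable_closed_triangle.
  move=> G [h1 h2 h3].
  have [e1|n1] := eqVneq (cross P Q G) 0; first by left; left; right; rewrite /L/= -crossE.
  have [e2|n2] := eqVneq (cross Q S G) 0; first by left; right; rewrite /L/= -crossE.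
  have [e3|n3] := eqVneq (cross S P G) 0; first by right; rewrite /L/= -crossE.
  by left; left; left; split; rewrite lt_neqAle eq_sym ?n1 ?n2 ?n3.
have e1 : cross Q S P = cross P Q S by rewrite /cross; ring.
have e2 : cross S P Q = cross P Q S by rewrite /cross; ring.
rewrite -(area_open_triangle (ltW D0)).
apply: (le_trans (area_U_le _ _)) => //; first by apply: pmeasurableU => //;
  apply: pmeasurableU => //; exact: pmeasurable_open_triangle.
rewrite (aL S P Q) ?e2// adde0.
apply: (le_trans (area_U_le _ _)) => //; first by apply: pmeasurableU => //;
  exact: pmeasurable_open_triangle.
rewrite (aL Q S P) ?e1// adde0.
apply: (le_trans (area_U_le _ _)) => //; first exact: pmeasurable_open_triangle.
by rewrite (aL P Q S) ?adde0.
Qed.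
End triangles.

(** * Convex sets in a box *)

Section planar.
Variable R : realType.
Implicit Types (P Q T G A B C D E F : R * R) (S : set (R * R)).

Definition pconvex S := forall P Q (l : R), S P -> S Q -> 0 <= l -> l <= 1 ->
  S (l * P.1 + (1 - l) * Q.1, l * P.2 + (1 - l) * Q.2).

Lemma pconvex3 S P Q T (u v w : R) : pconvex S -> S P -> S Q -> S T ->
  0 <= u -> 0 <= v -> 0 <= w -> u + v + w = 1 ->
  S (u * P.1 + v * Q.1 + w * T.1, u * P.2 + v * Q.2 + w * T.2).
Proof.
move=> cS SP SQ ST u0 v0 w0 uvw.
have [w1|w1] := eqVneq w 1.
  have [-> ->] : u = 0 /\ v = 0 by split; lra.
  by rewrite w1 !mul0r !add0r !mul1r; case: T ST.
have w1' : 0 < 1 - w by rewrite subr_gt0 lt_neqAle w1; lra.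
have h : 0 <= u / (1 - w) <= 1.
  apply/andP; split; first by apply: divr_ge0 => //; exact: ltW.
  by rewrite ler_pdivrMr// mul1r; lra.
have /andP[h0 h1] := h.
have := cS _ _ w ST (cS _ _ _ SP SQ h0 h1) w0.
have -> : w <= 1 by lra.
have vE : v = 1 - u - w by lra.
by move=> /(_ isT) /=; congr S; congr (_, _); rewrite vE; field; rewrite subr_eq0 eq_sym.
Qed.

Lemma cross_sum P Q T G : cross P Q T = cross P Q G + cross Q T G + cross T P G.
Proof. by rewrite /cross; ring. Qed.

Lemma cross_rev P Q G : cross Q P G = - cross P Q G.
Proof. by rewrite /cross; ring. Qed.

(** The crosses of G with the sides of PQT are its barycentric coordinates scaled by cross P Q T,
    and cross X Y is an affine function of its last argument. *)
Lemma cross_bary P Q T (X Y : R * R) G :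
  cross P Q T * cross X Y G =
  cross Q T G * cross X Y P + cross T P G * cross X Y Q + cross P Q G * cross X Y T.
Proof. by rewrite /cross; ring. Qed.

Lemma closed_triangle_sub S P Q T : pconvex S -> S P -> S Q -> S T -> 0 < cross P Q T ->
  closed_triangle P Q T `<=` S.
Proof.
move=> cS SP SQ ST D0 G [h1 h2 h3].
have Dn : cross P Q T != 0 by rewrite gt_eqF.
have -> : G = (cross Q T G / cross P Q T * P.1 + cross T P G / cross P Q T * Q.1 + cross P Q G / cross P Q T * T.1,
  cross Q T G / cross P Q T * P.2 + cross T P G / cross P Q T * Q.2 + cross P Q G / cross P Q T * T.2).
  rewrite [LHS]surjective_pairing; congr (_, _); apply: (mulfI Dn);
    rewrite !mulrDr ![cross P Q T * (_ / _ * _)]mulrA ![cross P Q T * (_ / _)]mulrC !divfK//;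
    by rewrite /cross; ring.
apply: pconvex3 => //; rewrite ?divr_ge0 ?(ltW D0)//.
by rewrite -!mulrDl (cross_sum P Q T G) -(cross_sum P Q T G) addrC addrA -cross_sum divff.
Qed.

Lemma open_triangle_sub S P Q T : pconvex S -> S P -> S Q -> S T -> open_triangle P Q T `<=` S.
Proof.
move=> cS SP SQ ST G [h1 h2 h3]; apply: (closed_triangle_sub cS SP SQ ST).
  by rewrite (cross_sum P Q T G); lra.
by split; exact: ltW.
Qed.

(** Used for disjointness: a triangle whose vertices lie on one side of the line XY lies on that
    side, by [cross_bary] with positive weights. *)
Lemma open_triangle_side P Q T (X Y : R * R) G : cross X Y P <= 0 -> cross X Y Q <= 0 ->
  cross X Y T <= 0 -> open_triangle P Q T G -> cross X Y G <= 0.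
Proof.
move=> hP hQ hT [h1 h2 h3].
have D0 : 0 < cross P Q T by rewrite (cross_sum P Q T G); lra.
rewrite -(pmulr_rle0 _ D0) cross_bary.
have := mulr_ge0_le0 (ltW h2) hP; have := mulr_ge0_le0 (ltW h3) hQ.
by have := mulr_ge0_le0 (ltW h1) hT; lra.
Qed.

Lemma cross_degenl P Q : cross P Q P = 0. Proof. by rewrite /cross; ring. Qed.
Lemma cross_degenr P Q : cross P Q Q = 0. Proof. by rewrite /cross; ring. Qed.

(* Listed counterclockwise, the vertices of the hexagon are A, C, E, B, D, F; it is cut along
   AB, BC and AD.  The last three hypotheses say that BC and AD separate the pieces. *)
Lemma hexagon_area S A C E B D F : pconvex S -> pmeasurable S ->
  S A -> S C -> S E -> S B -> S D -> S F ->
  0 <= cross A C B -> 0 <= cross A B D -> 0 <= cross C E B -> 0 <= cross D F A ->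
  cross B C D <= 0 -> cross B C F <= 0 -> cross A D C <= 0 ->
  (((cross A C B + cross A B D + cross C E B + cross D F A) / 2)%:E <= area S)%E.
Proof.
move=> cS mS SA SC SE SB SD SF h1 h2 h3 h4 hBCD hBCF hADC.
have hBCA : cross B C A <= 0 by rewrite (_ : cross B C A = - cross A C B) ?oppr_le0// /cross; ring.
have hADB : cross A D B <= 0 by rewrite (_ : cross A D B = - cross A B D) ?oppr_le0// /cross; ring.
have m P Q T : pmeasurable (open_triangle P Q T) by exact: pmeasurable_open_triangle.
have disj (X Y : set (R * R)) : (forall G, X G -> Y G -> False) -> X `&` Y = set0.
  by move=> h; apply/seteqP; split=> // G [/h]; apply.
have -> : (((cross A C B + cross A B D + cross C E B + cross D F A) / 2)%:E =
    area (open_triangle A C B `|` open_triangle A B D `|` open_triangle C E B `|` open_triangle D F A))%E.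
  rewrite area_U ?area_U ?area_open_triangle//; first by rewrite -!EFinD !mulrDl.
  - by apply: disj => G [_ _ g1] [g2 _ _]; have := cross_rev A B G; lra.
  - exact: pmeasurableU.
  - apply: disj => G [[_ g1 _]|g] [_ _ g2]; first by have := cross_rev B C G; lra.
    by have := @open_triangle_side A B D B C G;
      rewrite cross_degenl lexx => /(_ hBCA isT hBCD g); lra.
  - by apply: pmeasurableU => //; exact: pmeasurableU.
  (* DFA is separated from ACB and from ABD by the line AD, and from CEB by the line BC. *)
  - apply: disj => G [[g|[_ _ g]]|g] g'.
    + have := @open_triangle_side A C B A D G;
      rewrite cross_degenl lexx => /(_ isT hADC hADB g).
      by case: g'; lra.
    + by case: g' => _ _; have := cross_rev A D G; lra.
    + by have := @open_triangle_side D F A B C G hBCD hBCF hBCA g'; case: g; lra.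
apply: area_le => //; first by apply: pmeasurableU => //; apply: pmeasurableU => //;
  exact: pmeasurableU.
by move=> G [[[]|]|]; apply: open_triangle_sub.
Qed.

(** The triangles PQT and QPG lie on opposite sides of PQ, so their areas add. This is how a point
    outside a triangle is seen to increase the area. *)
Lemma two_triangles_area S P Q T G : pconvex S -> pmeasurable S -> S P -> S Q -> S T -> S G ->
  0 <= cross P Q T -> cross P Q G < 0 ->
  (((cross P Q T - cross P Q G) / 2)%:E <= area S)%E.
Proof.
move=> cS mS SP SQ ST SG h1 h2.
have h3 : 0 <= cross Q P G by rewrite cross_rev oppr_ge0 ltW.
have -> : ((cross P Q T - cross P Q G) / 2)%:E = area (open_triangle P Q T `|` open_triangle Q P G).
  rewrite area_U ?area_open_triangle//; try exact: pmeasurable_open_triangle.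
    by rewrite -EFinD -mulrDl [cross Q P G]cross_rev.
  apply/seteqP; split=> // X [[g1 _ _] [g2 _ _]].
  by have := cross_rev P Q X; lra.
apply: area_le => //; first by apply: pmeasurableU; exact: pmeasurable_open_triangle.
by move=> X []; apply: open_triangle_sub.
Qed.

(** A point of S strictly beyond a side would, by [two_triangles_area], make the area of S larger
    than that of the triangle; this is applied to each side in turn. *)
Lemma area_eq_closed_triangle S P Q T : pconvex S -> pmeasurable S -> S P -> S Q -> S T ->
  0 < cross P Q T -> area S = (cross P Q T / 2)%:E -> S = closed_triangle P Q T.
Proof.
move=> cS mS SP SQ ST D0 aS; apply/seteqP; split; last exact: closed_triangle_sub.
have side P' Q' T' G : S P' -> S Q' -> S T' -> S G -> cross P' Q' T' = cross P Q T ->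
  0 <= cross P' Q' G.
  move=> SP' SQ' ST' SG e; rewrite leNgt; apply/negP => h.
  have := two_triangles_area cS mS SP' SQ' ST' SG.
  by rewrite e aS lee_fin => /(_ (ltW D0) h); lra.
move=> G SG; split; first exact: (side P Q T).
  by apply: (side Q T P) => //; rewrite /cross; ring.
by apply: (side T P Q) => //; rewrite /cross; ring.
Qed.

(* This is the case of the hexagon where E lies near C and F near A: x and y are the distances
   by which C and A would have to be moved along the sides of the box until they are extremal
   for x - y, and the last hypothesis is the width condition in that direction. *)
Lemma corner_alg (s t a b c d x y : R) : 0 < s -> - t <= a -> b <= t ->
  - s <= c -> d <= s -> a <= b -> c <= d -> 0 <= x -> 0 <= y -> s <= t ->
  t - s <= a + c + x + y ->
  (b - a) * (d - c) - (b + t) * x - (d + s) * y <= s ^+ 2 /\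
  ((b - a) * (d - c) - (b + t) * x - (d + s) * y = s ^+ 2 ->
   [/\ a = t - s, b = t, c = 0 & d = s]).
Proof.
move=> s0 ta bt sc ds ab cd x0 y0 st hxy.
have s2 : 0 < s ^+ 2 by rewrite exprn_gt0.
have ax : 0 <= (a + t) * x by apply: mulr_ge0 => //; lra.
have cy : 0 <= (c + s) * y by apply: mulr_ge0 => //; lra.
have xy : 0 <= x * y by apply: mulr_ge0.
set L := (b - a) * (d - c) - _ - _.
have LE : L = (b - a - y) * (d - c - x) - x * y - (a + t) * x - (c + s) * y.
  by rewrite /L; ring.
(* If one of the factors of the product in [LE] is not positive, then [L] itself is at most 0, hence
   below s^2. Excluding these cases prevents two negative factors from giving a large product. *)
have [qx|qx] := leP (d - c) x.
  have h1 : (b - a) * (d - c) <= (b - a) * x by apply: ler_wpM2l => //; lra.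
  have h2 : 0 <= (d - c) * y by apply: mulr_ge0 => //; lra.
  by have h : L <= 0; [rewrite /L; lra|split; lra].
have [py|py] := leP (b - a) y.
  have h1 : (b - a) * (d - c) <= y * (d - c) by apply: ler_wpM2r => //; lra.
  have h2 : 0 <= (b - a) * x by apply: mulr_ge0 => //; lra.
  by have h : L <= 0; [rewrite /L; lra|split; lra].
have p0 : 0 < b - a - y by lra.
have q0 : 0 < d - c - x by lra.
(* Replacing b by t and d by s enlarges both factors to [u] and [v]. The width condition gives u + v
   <= 2s, and then u v <= s^2 by the inequality between arithmetic and geometric mean. *)
pose u := t - a - y; pose v := s - c - x.
have u0 : 0 < u by rewrite /u; lra.
have v0 : 0 < v by rewrite /v; lra.
have uv2 : u + v <= 2 * s by rewrite /u /v; lra.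
have bt' : 0 <= (t - b) * (d - c - x) by apply: mulr_ge0; lra.
have ds' : 0 <= (s - d) * u by apply: mulr_ge0; lra.
have e1 : u * v = (b - a - y) * (d - c - x) + (t - b) * (d - c - x) + (s - d) * u.
  by rewrite /u /v; ring.
have sq1 : (u + v) * (u + v) <= (2 * s) * (2 * s) by apply: ler_pM; lra.
have e2 : 4 * (u * v) = (u + v) * (u + v) - (u - v) ^+ 2 by ring.
have sq2 := sqr_ge0 (u - v).
have e3 : (2 * s) * (2 * s) = 4 * s ^+ 2 by ring.
split; first by rewrite LE; lra.
(* Under equality every discarded nonnegative term vanishes, which forces u = v = s, b = t and d =
   s. *)
rewrite LE => eqL.
have /eqP : (u - v) ^+ 2 = 0 by lra.
rewrite sqrf_eq0 subr_eq0 => /eqP uv.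
have us : u = s.
  have e4 : u * v = s ^+ 2 by lra.
  have /eqP : (u - s) * (u + s) = 0.
    rewrite uv in e4; rewrite uv (_ : _ * _ = v * v - s ^+ 2); first by rewrite e4 subrr.
    by ring.
  by rewrite mulf_eq0 => /orP[] /eqP; lra.
have /eqP : (t - b) * (d - c - x) = 0 by lra.
rewrite mulf_eq0 [X in _ || X]gt_eqF// orbF => /eqP tb.
have /eqP : (s - d) * u = 0 by lra.
rewrite mulf_eq0 [X in _ || X]gt_eqF// orbF => /eqP sd.
have xy0 : x * y = 0 by lra.
have ax0 : (a + t) * x = 0 by lra.
have cy0 : (c + s) * y = 0 by lra.
have vs : v = s by rewrite -uv.
(* From u = s one gets a + t = 2t - s - y, so (a + t) x = 0 and x y = 0 leave (2t - s) x = 0, where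
   2t - s is positive. *)
have x_0 : x = 0.
  have y1 : a + t = 2 * t - s - y by move: us; rewrite /u; lra.
  move: ax0; rewrite y1 mulrBl [y * x]mulrC xy0 subr0 => /eqP.
  by rewrite mulf_eq0 => /orP[] /eqP; lra.
have y_0 : y = 0.
  have c1 : c = 0 by move: vs; rewrite /v; lra.
  by move: cy0; rewrite c1 add0r => /eqP; rewrite mulf_eq0 => /orP[] /eqP; lra.
by move: us vs; rewrite /u /v; split; lra.
Qed.

Definition left_vertex (s t : R) : R * R := (- s, t - s).
Definition right_vertex (s t : R) : R * R := (s, t).
Definition bottom_vertex (t : R) : R * R := (0, - t).
(** The triangle T_{s,t} as an intersection of half-planes, with its vertices in counterclockwise
    order; [triangleE] matches it with the convex hull. *)
Definition std_triangle (s t : R) : set (R * R) :=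
  closed_triangle (left_vertex s t) (bottom_vertex t) (right_vertex s t).

(* The left-hand side is twice the area of CEB.  It is affine as E moves along a line x - y = e,
   hence least when E reaches a side of the box. *)
Lemma corner_triangle (s t b c e1 e2 : R) : e1 <= s -> - t <= e2 ->
  (e1 - c) * (b + t) - (e2 + t) * (s - c) >= (s - c) * (e1 - e2 - (s - b)) \/
  (e1 - c) * (b + t) - (e2 + t) * (s - c) >= (b + t) * (e1 - e2 - (c + t)).
Proof.
move=> h1 h2; have [h|h] := leP (b + t) (s - c); [left|right].
  have : 0 <= (s - c - (b + t)) * (s - e1) by apply: mulr_ge0; lra.
  by lra.
have : 0 <= (b + t - (s - c)) * (e2 + t) by apply: mulr_ge0; lra.
by lra.
Qed.

End planar.

(** * The hexagon bound and its equality cases *)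

Section box.
Variable R : realType.
Implicit Types (P Q T G A B C D E F : R * R).

(* The two alternatives for each of TE and TF come from [corner_triangle]; two of the four
   combinations are the case of [corner_alg] and its reflection through the origin, and in the
   other two the corner triangles already compensate the whole term (b - a) (d - c). *)
Lemma hexagon_alg (s t a b c d e f TE TF : R) :
  0 < s -> s <= t -> - t <= a -> b <= t -> - s <= c -> d <= s ->
  a <= b -> c <= d -> f <= - s - a -> s - b <= e -> c + t <= e -> f <= d - t ->
  2 * t <= e - f ->
  (s - c) * (e - (s - b)) <= TE \/ (b + t) * (e - (c + t)) <= TE ->
  (d + s) * (- s - a - f) <= TF \/ (t - a) * (d - t - f) <= TF ->
  [/\ 0 <= TE, 0 <= TF, (b - a) * (d - c) - TE - TF <= s ^+ 2 &
    (b - a) * (d - c) - TE - TF = s ^+ 2 ->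
    [/\ a = t - s, b = t, c = 0 & d = s] \/ [/\ a = - t, b = s - t, c = - s & d = 0]].
Proof.
move=> s0 st ta bt sc ds ab cd fA eB eC fD wef hE hF.
have s2 : 0 < s ^+ 2 by rewrite exprn_gt0.
have p0 : 0 <= b - a by rewrite subr_ge0.
have q0 : 0 <= d - c by rewrite subr_ge0.
have c0 : 0 <= s - c by rewrite subr_ge0 (le_trans cd ds).
have b0 : 0 <= b + t by rewrite -[t]opprK subr_ge0 (le_trans ta ab).
have d0 : 0 <= d + s by rewrite -[s]opprK subr_ge0 (le_trans sc cd).
have a0 : 0 <= t - a by rewrite subr_ge0 (le_trans ab bt).
have xB : 0 <= e - (s - b) by rewrite subr_ge0.
have xC : 0 <= e - (c + t) by rewrite subr_ge0.
have xA : 0 <= - s - a - f by rewrite subr_ge0.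
have xD : 0 <= d - t - f by rewrite subr_ge0.
have TE0 : 0 <= TE by case: hE; apply: le_trans; exact: mulr_ge0.
have TF0 : 0 <= TF by case: hF; apply: le_trans; exact: mulr_ge0.
suff [h1 h2] : (b - a) * (d - c) - TE - TF <= s ^+ 2 /\
    ((b - a) * (d - c) - TE - TF = s ^+ 2 ->
    [/\ a = t - s, b = t, c = 0 & d = s] \/ [/\ a = - t, b = s - t, c = - s & d = 0]).
  by [].
(* Once [TE + TF] reaches (b - a) (d - c), the quantity to bound is at most 0 and equality with s^2
   > 0 cannot occur. *)
have easy (z : R) : (b - a) * (d - c) <= z -> z <= TE + TF ->
    (b - a) * (d - c) - TE - TF <= s ^+ 2 /\
    ((b - a) * (d - c) - TE - TF = s ^+ 2 ->
    [/\ a = t - s, b = t, c = 0 & d = s] \/ [/\ a = - t, b = s - t, c = - s & d = 0]).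
  by clear -s2 => h1 h2; split; lra.
case: hE => hE; case: hF => hF.
(* The two lengths add up to e - f - 2s + (b - a), at least b - a because e - f >= 2t >= 2s, and
   both coefficients s - c and d + s are at least d - c. *)
- apply: (easy _ _ (lerD hE hF)).
  apply: (@le_trans _ _ ((d - c) * (e - (s - b)) + (d - c) * (- s - a - f))).
    rewrite mulrC -mulrDr; apply: (ler_wpM2l q0).
    by clear -wef st; lra.
  by apply: lerD; apply: ler_wpM2r => //; clear -sc ds; lra.
(* Reflection through the origin exchanges A with B and C with D, so E near B and F near D becomes
   the case of [corner_alg]. *)
- have [] := @corner_alg R s t (- b) (- a) (- d) (- c) (d - t - f) (e - (s - b)).
  all: rewrite ?lerN2 ?opprK //; try (by clear -ta bt sc ds; lra).
    by clear -wef; lra.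
  have -> : (- a + b) * (- c + d) = (b - a) * (d - c) by ring.
  rewrite [- a + t]addrC [- c + s]addrC => h1 h2.
  clear -h1 h2 hE hF; split; first lra.
  by move=> h; have [|? ? ? ?] := h2; [lra|right; split; lra].
- have [] := @corner_alg R s t a b c d (e - (c + t)) (- s - a - f) => //.
    by clear -wef; lra.
  move=> h1 h2.
  clear -h1 h2 hE hF; split; first lra.
  by move=> h; have [|? ? ? ?] := h2; [lra|left; split].
(* Here the two lengths add up to e - f - 2t + (d - c) >= d - c, and both coefficients b + t and t -
   a are at least b - a. *)
- apply: (easy _ _ (lerD hE hF)).
  apply: (@le_trans _ _ ((b - a) * (e - (c + t)) + (b - a) * (d - t - f))).
    rewrite -mulrDr; apply: (ler_wpM2l p0).
    by clear -wef; lra.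
  by apply: lerD; apply: ler_wpM2r => //; clear -ta bt; lra.
Qed.

(** These are sign conditions required by [hexagon_area]; the first two expressions are the crosses
    of A, C, B and of A, B, D. All but the last are sums of products of distances to the sides of
    the box. The last places F on the side of BC where A lies, since x - y is no larger at F than at
    B and C. *)
Lemma hexagon_signs (s t a b c d f1 f2 : R) :
  0 < s -> - t <= a -> b <= t -> - s <= c -> d <= s -> a <= b -> c <= d ->
  f1 <= s -> - t <= f2 -> f1 - f2 <= s - b -> f1 - f2 <= c + t ->
  [/\ 0 <= (c + s) * (b - a) + 2 * s * (t + a),
      0 <= 2 * s * (t - a) - (b - a) * (d + s),
      cross (s, b) (c, - t) (d, t) <= 0, cross (- s, a) (d, t) (c, - t) <= 0 &
      cross (s, b) (c, - t) (f1, f2) <= 0].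
Proof.
move=> s0 ta bt sc ds ab cd f1s f2t fB fC.
have p0 : 0 <= b - a by rewrite subr_ge0.
have c0 : 0 <= s - c by rewrite subr_ge0 (le_trans cd ds).
have c0' : 0 <= c + s by rewrite -[s]opprK subr_ge0.
have b0 : 0 <= b + t by rewrite -[t]opprK subr_ge0 (le_trans ta ab).
have b0' : 0 <= t - b by rewrite subr_ge0.
have d0 : 0 <= d + s by rewrite -[s]opprK subr_ge0 (le_trans sc cd).
have d0' : 0 <= s - d by rewrite subr_ge0.
have a0 : 0 <= t - a by rewrite subr_ge0 (le_trans ab bt).
have a0' : 0 <= t + a by rewrite addrC -[t]opprK subr_ge0.
have s0' : 0 <= 2 * s by apply: mulr_ge0 => //; exact: ltW.
split.
- by apply: addr_ge0; apply: mulr_ge0.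
- rewrite (_ : _ - _ = (2 * s) * (t - b) + (b - a) * (s - d)); last by ring.
  by apply: addr_ge0; apply: mulr_ge0.
- rewrite (_ : cross _ _ _ = - ((s - c) * (t - b) + (b + t) * (s - d)));
  last by rewrite /cross /=; ring.
  by rewrite oppr_le0; apply: addr_ge0; apply: mulr_ge0.
- rewrite (_ : cross _ _ _ = - ((d + s) * (t + a) + (t - a) * (c + s)));
  last by rewrite /cross /=; ring.
  by rewrite oppr_le0; apply: addr_ge0; apply: mulr_ge0.
have f0 : 0 <= f2 + t by rewrite -[t]opprK subr_ge0.
have f0' : 0 <= s - f1 by rewrite subr_ge0.
(* When the line CB has slope at most 1, F is compared with C and the bottom side; otherwise with B
   and the right side. *)
have [h|/ltW h] := leP (b + t) (s - c).
  rewrite (_ : cross _ _ _ = (b + t) * (f1 - c) - (s - c) * (f2 + t));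
    last by rewrite /cross /=; ring.
  rewrite subr_le0; apply: (@le_trans _ _ ((b + t) * (f2 + t))).
    by apply: (ler_wpM2l b0); clear -fC; lra.
  exact: ler_wpM2r.
rewrite (_ : cross _ _ _ = (s - c) * (b - f2) - (b + t) * (s - f1));
  last by rewrite /cross /=; ring.
rewrite subr_le0; apply: (@le_trans _ _ ((s - c) * (s - f1))).
  by apply: (ler_wpM2l c0); clear -fB; lra.
exact: ler_wpM2r.
Qed.

Lemma hexagon_bound (s t : R) (S : set (R * R)) (a b c d e1 e2 f1 f2 : R) :
  0 < s -> s <= t -> pconvex S -> pmeasurable S ->
  (forall G, S G -> [/\ - s <= G.1, G.1 <= s, - t <= G.2 & G.2 <= t]) ->
  S (- s, a) -> S (s, b) -> S (c, - t) -> S (d, t) -> S (e1, e2) -> S (f1, f2) ->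
  (forall G, S G -> f1 - f2 <= G.1 - G.2 <= e1 - e2) ->
  2 * t <= (e1 - e2) - (f1 - f2) -> a <= b -> c <= d ->
  ((2 * s * t - s ^+ 2 / 2)%:E <= area S)%E /\
  (area S = (2 * s * t - s ^+ 2 / 2)%:E ->
   S = std_triangle s t \/
   S = [set G | std_triangle s t (- G.1, - G.2)]).
Proof.
move=> s0 st cS mS box SA SB SC SD SE SF xy wxy ab cd.
have [/= _ _ a1 a2] := box _ SA; have [/= _ _ b1 b2] := box _ SB.
have [/= c1 c2 _ _] := box _ SC; have [/= d1 d2 _ _] := box _ SD.
have [/= _ e1u e2l _] := box _ SE; have [/= f1l f1u f2l f2u] := box _ SF.
have /andP[/= fA _] := xy _ SA; have /andP[/= fB eB] := xy _ SB.
have /andP[/= fC eC] := xy _ SC; have /andP[/= fD _] := xy _ SD.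
rewrite opprK in fC eC.
(* [TE] and [TF] are twice the signed areas of CEB and DFA. [TF] is written as the [TE] of the
   configuration reflected through the origin, so that [corner_triangle] serves for both. *)
pose TE := (e1 - c) * (b + t) - (e2 + t) * (s - c).
pose TF := (- f1 - - d) * (- a + t) - (- f2 + t) * (s - - d).
have [TE0 TF0 alg1 alg2] : [/\ 0 <= TE, 0 <= TF, (b - a) * (d - c) - TE - TF <= s ^+ 2 &
    (b - a) * (d - c) - TE - TF = s ^+ 2 ->
    [/\ a = t - s, b = t, c = 0 & d = s] \/ [/\ a = - t, b = s - t, c = - s & d = 0]].
  apply: (hexagon_alg s0 st a1 b2 c1 d2 ab cd fA eB eC fD wxy).
    exact: corner_triangle.
  have := @corner_triangle R s t (- a) (- d) (- f1) (- f2).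
  rewrite lerNl lerN2 -/TF => /(_ f1l f2u).
  have -> : s - - d = d + s by ring.
  have -> : - f1 - - f2 - (s - - a) = - s - a - (f1 - f2) by ring.
  have -> : - a + t = t - a by ring.
  by have -> : - f1 - - f2 - (- d + t) = d - t - (f1 - f2) by ring.
have [hACB hABD hBCD hADC hBCF] := hexagon_signs s0 a1 b2 c1 d2 ab cd f1u f2l fB fC.
have hex := hexagon_area cS mS SA SC SE SB SD SF.
have crACB : cross (- s, a) (c, - t) (s, b) = (c + s) * (b - a) + 2 * s * (t + a).
  by rewrite /cross /=; ring.
have crABD : cross (- s, a) (s, b) (d, t) = 2 * s * (t - a) - (b - a) * (d + s).
  by rewrite /cross /=; ring.
have crCEB : cross (c, - t) (e1, e2) (s, b) = TE by rewrite /cross /TE /=; ring.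
have crDFA : cross (d, t) (f1, f2) (- s, a) = TF by rewrite /cross /TF /=; ring.
rewrite crACB crABD crCEB crDFA in hex.
have {}hex : ((2 * s * t - ((b - a) * (d - c) - TE - TF) / 2)%:E <= area S)%E.
  have := hex hACB hABD TE0 TF0 hBCD hBCF hADC; congr (is_true (_%:E <= _)%E).
  by clear; field.
split; first by apply: le_trans hex; rewrite lee_fin; clear -alg1; lra.
move=> aS; rewrite aS lee_fin in hex.
have tri0 : 0 < s * s + 2 * s * (2 * t - s).
  by clear -s0 st; apply: addr_gt0; apply: mulr_gt0; lra.
case: alg2 => [|[eA eB' eC']|[eA eB' eC' eD']]; first by clear -alg1 hex; lra.
  rewrite eA in SA; rewrite eB' in SB; rewrite eC' in SC.
  have cross_tri : cross (left_vertex s t) (bottom_vertex t) (right_vertex s t) = s * s + 2 * s * (2 * t - s).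
    by rewrite /cross /left_vertex /right_vertex /bottom_vertex /=; ring.
  by left; apply: area_eq_closed_triangle; rewrite ?cross_tri// aS; congr (_%:E); clear; field.
rewrite eA in SA; rewrite eB' in SB; rewrite eD' in SD.
(* The second equality case has vertices A, B, D instead of A, B, C and is the reflected triangle
   -T_{s,t}. *)
have cross_tri : cross (- s, - t) (s, s - t) (0, t) = s * s + 2 * s * (2 * t - s).
  by rewrite /cross /=; ring.
have SE' : S = closed_triangle (- s, - t) (s, s - t) (0, t).
  by apply: area_eq_closed_triangle; rewrite ?cross_tri// aS; congr (_%:E); clear; field.
right; rewrite SE'; apply: eq_set => G;
  rewrite /std_triangle /closed_triangle /left_vertex /right_vertex /bottom_vertex /=;
  apply/propext.
have N P Q : cross (- P.1, - P.2) (- Q.1, - Q.2) (- G.1, - G.2) = cross P Q G.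
  by rewrite /cross /=; ring.
have := N (s, s - t) (0, t); have := N (0, t) (- s, - t); have := N (- s, - t) (s, s - t).
by rewrite /= !opprK oppr0 opprB => -> -> ->; split=> -[].
Qed.
End box.

(** * The area bound for all positions of the contact points *)

Section planar_bound.
Variable R : realType.
Implicit Types (P Q T G A B C D E F : R * R).

(** This is [hexagon_area] with E = C and F = A, so that both corner triangles degenerate; no sign
    of b - a or d - c is assumed. *)
Lemma quadrilateral_area (s t : R) (S : set (R * R)) (a b c d : R) :
  pconvex S -> pmeasurable S ->
  (forall G, S G -> [/\ - s <= G.1, G.1 <= s, - t <= G.2 & G.2 <= t]) ->
  S (- s, a) -> S (s, b) -> S (c, - t) -> S (d, t) ->
  ((2 * s * t - (b - a) * (d - c) / 2)%:E <= area S)%E.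
Proof.
move=> cS mS box SA SB SC SD.
have [/= _ _ a1 a2] := box _ SA; have [/= _ _ b1 b2] := box _ SB.
have [/= c1 c2 _ _] := box _ SC; have [/= d1 d2 _ _] := box _ SD.
have g1 : 0 <= s + c by rewrite addrC -[s]opprK subr_ge0.
have g2 : 0 <= s - c by rewrite subr_ge0.
have g3 : 0 <= s + d by rewrite addrC -[s]opprK subr_ge0.
have g4 : 0 <= s - d by rewrite subr_ge0.
have g5 : 0 <= t + a by rewrite addrC -[t]opprK subr_ge0.
have g6 : 0 <= t - a by rewrite subr_ge0.
have g7 : 0 <= t + b by rewrite addrC -[t]opprK subr_ge0.
have g8 : 0 <= t - b by rewrite subr_ge0.
have := hexagon_area cS mS SA SC SC SB SD SA.
have -> : cross (- s, a) (c, - t) (s, b) = (s - c) * (t + a) + (s + c) * (t + b).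
  by rewrite /cross /=; ring.
have -> : cross (- s, a) (s, b) (d, t) = (s - d) * (t - a) + (s + d) * (t - b).
  by rewrite /cross /=; ring.
have -> : cross (c, - t) (c, - t) (s, b) = 0 by rewrite /cross /=; ring.
have -> : cross (d, t) (- s, a) (- s, a) = 0 by rewrite /cross /=; ring.
have -> : cross (s, b) (c, - t) (d, t) = - ((s - c) * (t - b) + (t + b) * (s - d)).
  by rewrite /cross /=; ring.
have -> : cross (s, b) (c, - t) (- s, a) = - ((s - c) * (t + a) + (s + c) * (t + b)).
  by rewrite /cross /=; ring.
have -> : cross (- s, a) (d, t) (c, - t) = - ((s + d) * (t + a) + (t - a) * (s + c)).
  by rewrite /cross /=; ring.
have k1 : 0 <= (s - c) * (t + a) + (s + c) * (t + b).
  by apply: addr_ge0; apply: mulr_ge0.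
have k2 : 0 <= (s - d) * (t - a) + (s + d) * (t - b).
  by apply: addr_ge0; apply: mulr_ge0.
have k3 : 0 <= (s - c) * (t - b) + (t + b) * (s - d).
  by apply: addr_ge0; apply: mulr_ge0.
have k4 : 0 <= (s + d) * (t + a) + (t - a) * (s + c).
  by apply: addr_ge0; apply: mulr_ge0.
rewrite !oppr_le0 k1 k2 k3 k4 lexx => /(_ isT isT isT isT isT isT isT).
apply: le_trans.
by rewrite lee_fin le_eqVlt; apply/orP; left; apply/eqP; clear; field.
Qed.

(** The signs of b - a and d - c decide. If their product is not positive, the quadrilateral has
    area at least 2st, so equality is impossible. Otherwise [hexagon_bound] applies to S or to its
    mirror image, which is why the widths along both x - y and x + y are needed. *)
Lemma planar_bound (s t : R) (S : set (R * R)) (a b c d e1 e2 f1 f2 e1' e2' f1' f2' : R) :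
  0 < s -> s <= t -> pconvex S -> pmeasurable S ->
  (forall G, S G -> [/\ - s <= G.1, G.1 <= s, - t <= G.2 & G.2 <= t]) ->
  S (- s, a) -> S (s, b) -> S (c, - t) -> S (d, t) -> S (e1, e2) -> S (f1, f2) ->
  (forall G, S G -> f1 - f2 <= G.1 - G.2 <= e1 - e2) ->
  2 * t <= (e1 - e2) - (f1 - f2) ->
  S (e1', e2') -> S (f1', f2') ->
  (forall G, S G -> f1' + f2' <= G.1 + G.2 <= e1' + e2') ->
  2 * t <= (e1' + e2') - (f1' + f2') ->
  ((2 * s * t - s ^+ 2 / 2)%:E <= area S)%E /\
  (area S = (2 * s * t - s ^+ 2 / 2)%:E ->
   exists x y : bool, S =
     [set G | std_triangle s t ((-1) ^+ x * G.1, (-1) ^+ y * G.2)]).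
Proof.
move=> s0 st cS mS box SA SB SC SD SE SF xy wxy SE' SF' xy' wxy'.
have s2 : 0 < s ^+ 2 by rewrite exprn_gt0.
have quad : (b - a) * (d - c) <= 0 ->
  ((2 * s * t - s ^+ 2 / 2)%:E <= area S)%E /\
  (area S = (2 * s * t - s ^+ 2 / 2)%:E ->
   exists x y : bool, S =
     [set G | std_triangle s t ((-1) ^+ x * G.1, (-1) ^+ y * G.2)]).
  move=> pq; have h := quadrilateral_area cS mS box SA SB SC SD.
  split; first by apply: le_trans h; rewrite lee_fin; clear -pq s2; lra.
  by move=> aS; move: h; rewrite aS lee_fin => h; clear -pq s2 h; lra.
have [ab|/ltW ab] := leP a b; have [cd|/ltW cd] := leP c d.
- have [h1 h2] := hexagon_bound s0 st cS mS box SA SB SC SD SE SF xy wxy ab cd.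
  split=> // /h2[->|->]; [exists false, false|exists true, true];
  by apply: eq_set => G; rewrite ?mulN1r ?mul1r.
- by apply: quad; apply: mulr_ge0_le0; rewrite ?subr_ge0 ?subr_le0.
- by apply: quad; apply: mulr_le0_ge0; rewrite ?subr_ge0 ?subr_le0.
(* The reflection in the vertical axis exchanges A and B, changes the signs of c and d, and turns
   -(x + y) into x - y; the extremal points for x + y therefore change roles. *)
pose S' := [set G : R * R | S (- G.1, G.2)].
have S'E : S' = [set G : R * R | S (-1 * G.1 + 0 * G.2 + 0, 0 * G.1 + 1 * G.2 + 0)].
  by apply: eq_set => G /=; congr (S (_, _)); ring.
have SS' : S = [set G | S' (- G.1, G.2)].
  by apply: eq_set => -[x y]; rewrite /S' /= opprK.
have mS' : pmeasurable S' by rewrite S'E; exact: pmeasurable_affine.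
have aS' : area S' = area S.
  have D1 : (-1) * 1 - 0 * 0 != 0 :> R by rewrite mulr0 subr0 mulr1 oppr_eq0 oner_neq0.
  rewrite -[RHS](area_affine 0 0 D1 mS) -S'E.
  by rewrite mulr0 subr0 mulr1 normrN1 mul1e.
have cS' : pconvex S'.
  move=> P Q l SP SQ l0 l1; have := cS _ _ l SP SQ l0 l1; rewrite /S' /=.
  by rewrite !mulrN -opprD.
have box' G : S' G -> [/\ - s <= G.1, G.1 <= s, - t <= G.2 & G.2 <= t].
  by move=> /box[/=]; rewrite lerN2 lerNl => -> -> -> ->.
have [||||||G SG||||h1 h2] :=
  @hexagon_bound R s t S' b a (- c) (- d) (- f1') f2' (- e1') e2' s0 st cS' mS' box'.
all: rewrite /S' /= ?opprK //.
- have /= /andP[k1 k2] := xy' _ SG.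
  by clear -k1 k2; apply/andP; split; lra.
- by clear -wxy'; lra.
- by rewrite lerN2.
rewrite aS' in h1 h2; split=> // /h2 E; rewrite SS'.
case: E => ->; [exists true, false|exists false, true];
  by apply: eq_set => G; rewrite /= ?opprK ?mulN1r ?mul1r ?opprK.
Qed.
End planar_bound.

(** * Reduced bases of the plane lattice *)

Section lattice.
Variables (R : realType) (f : int -> int -> R) (r : R).
Hypotheses (r0 : 0 < r) (f_coercive : forall m n : int, r * (`|m| + `|n|)%:~R <= f m n).
Hypotheses (fZ : forall k m n : int, f (k * m) (k * n) = `|k|%:~R * f m n).
Hypotheses (fD : forall m n m' n' : int, f (m + m') (n + n') <= f m n + f m' n').

(** By coercivity only finitely many lattice points have a value not exceeding that of a given one,
    so a minimum over a finite square suffices. *)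
Lemma lattice_argmin (P : int -> int -> Prop) : (exists m n, P m n) ->
  exists m n, P m n /\ forall m' n', P m' n' -> f m n <= f m' n'.
Proof.
move=> [m0 [n0 P0]].
have [B fB] : exists B : nat, f m0 n0 < r * B%:R.
  exists (Num.bound `|f m0 n0 / r|).
  rewrite mulrC -ltr_pdivrMr//; apply: le_lt_trans (ler_norm _) _.
  exact: (archi_boundP (normr_ge0 _)).
(* [g] enumerates the 2B + 1 integers from -B to B. *)
pose g (i : 'I_(2 * B).+1) : int := (i : nat)%:Z - B%:Z.
have gB (m n : int) : f m n <= f m0 n0 -> (`|m| <= B)%N /\ (`|n| <= B)%N.
  move=> fmn; have : r * (`|m| + `|n|)%:~R < r * B%:R.
    by apply: le_lt_trans fB; apply: le_trans fmn.
  rewrite ltr_pM2l// => h.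
  have : (`|m| + `|n|)%R < B%:Z by rewrite -(ltr_int R); exact: h.
  by lia.
have gs (m : int) : (`|m| <= B)%N -> exists i, g i = m.
  move=> mB; have h : (`|(m + B%:Z)%R|%N < (2 * B).+1)%N by lia.
  by exists (Ordinal h); rewrite /g /=; lia.
have [/gs[i0 i0E] /gs[j0 j0E]] := gB _ _ (lexx (f m0 n0)).
pose Q := [pred ij : 'I_(2 * B).+1 * 'I_(2 * B).+1 | `[< P (g ij.1) (g ij.2) >]].
have Q0 : Q (i0, j0) by rewrite /Q /= i0E j0E; apply/asboolP.
have [[i j] /asboolP Pij min_ij] := arg_minP (fun ij => f (g ij.1) (g ij.2)) Q0.
exists (g i), (g j); split=> // m n Pmn; have [h|/ltW h] := leP (f m n) (f m0 n0).
  have [/gs[k kE] /gs[l lE]] := gB _ _ h.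
  have := min_ij (k, l); rewrite /Q /= kE lE; apply; exact/asboolP.
by apply: le_trans h; have := min_ij (i0, j0) Q0; rewrite /= i0E j0E.
Qed.

Lemma coercive_gt0 (m n : int) : (m != 0) || (n != 0) -> 0 < f m n.
Proof.
move=> mn; apply: lt_le_trans (f_coercive _ _); apply: mulr_gt0 => //.
by rewrite ltr0z; case/orP: mn => h; lia.
Qed.

(** Gauss reduction: z1 = (a1, b1) is a shortest nonzero vector and z2 = (a2, b2) a shortest one
    completing it to a basis of determinant 1. Minimality of z2 is then extended from the vectors z2
    + k z1 to all vectors off the line of z1. *)
Lemma reduced_basis : exists a1 b1 a2 b2 : int,
  [/\ a1 * b2 - a2 * b1 = 1,
    forall m n : int, (m != 0) || (n != 0) -> f a1 b1 <= f m n &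
    forall m n : int, n != 0 -> f a2 b2 <= f (m * a1 + n * a2) (m * b1 + n * b2)].
Proof.
have [a1 [b1 [z1 min1]]] := @lattice_argmin (fun m n => (m != 0) || (n != 0))
  (ex_intro _ 1 (ex_intro _ 0 isT)).
(* A shortest vector is primitive, because dividing by the gcd would shorten it. *)
have g1 : gcdz a1 b1 = 1.
  have /dvdzP[a' aE] := dvdz_gcdl a1 b1; have /dvdzP[b' bE] := dvdz_gcdr a1 b1.
  have g0 : gcdz a1 b1 != 0.
    by rewrite gcdz_eq0 negb_and.
  have gp : 0 < gcdz a1 b1 by rewrite lt_neqAle eq_sym g0 /gcdz lez_nat.
  have z' : (a' != 0) || (b' != 0).
    by apply: contraT; rewrite negb_or !negbK => /andP[/eqP a0 /eqP b0];
      move: z1; rewrite aE bE a0 b0 !mul0r eqxx.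
  have fE : f a1 b1 = (gcdz a1 b1)%:~R * f a' b'.
    by rewrite -[X in X%:~R](gtr0_norm gp) -fZ ![gcdz a1 b1 * _]mulrC -aE -bE.
  have := min1 a' b' z'; rewrite fE ger_pMl ?coercive_gt0// (ler_int _ _ 1) => h.
  by apply/le_anti; rewrite h; lia.
have [u [v uv]] := Bezoutz a1 b1.
have [|a2 [b2 [det1 min2]]] := @lattice_argmin (fun m n => a1 * n - m * b1 = 1).
  by exists (- v), u; move: uv; rewrite g1 => <-; ring.
exists a1, b1, a2, b2; split=> // m n n0.
have f2 : f a1 b1 <= f a2 b2.
  apply: min1; apply: contraT; rewrite negb_or !negbK => /andP[/eqP a0 /eqP b0].
  by move: det1; rewrite a0 b0 mulr0 mul0r subrr.
have f1p := coercive_gt0 z1; have fp2 : 0 < f a2 b2 by apply: lt_le_trans f2.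
have fN m' n' : f (- m') (- n') = f m' n'.
  by rewrite -mulN1r -[- n']mulN1r fZ normrN1 mul1r.
wlog n_gt0 : m n n0 / 0 < n.
  move=> wl; have [h|h|h] := ltgtP n 0; [|exact: wl|by rewrite h in n0].
  rewrite -[leRHS]fN !opprD -!mulNr; apply: wl; first by rewrite oppr_eq0.
  by rewrite oppr_gt0.
have det k : f a2 b2 <= f (a2 + k * a1) (b2 + k * b1).
  by apply: min2; rewrite -det1; ring.
have [n1|n1] := eqVneq n 1.
  by rewrite n1 !mul1r addrC [m * b1 + _]addrC.
(* k is an integer nearest to m / n *)
have [k hk] : exists k : int, 2 * `|n * k - m| <= n.
  exists ((2 * m + n) %/ (2 * n))%Z.
  have h1 := divz_eq (2 * m + n) (2 * n).
  have h2 : 0 <= ((2 * m + n) %% (2 * n))%Z by rewrite modz_ge0//; lia.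
  have h3 : ((2 * m + n) %% (2 * n))%Z < 2 * n by rewrite ltz_pmod//; lia.
  set q := (_ %/ _)%Z in h1 *; set rr := (_ %% _)%Z in h1 h2 h3.
  have : 2 * (n * q - m) = n - rr by lia.
  by move: (n * q - m) => w; lia.
(* The triangle inequality for n (z2 + k z1) = (m z1 + n z2) + (n k - m) z1. As |n k - m| <= n / 2
   and f z1 <= f z2, it yields f (m z1 + n z2) >= (n / 2) f z2, enough for n >= 2. *)
have step : n%:~R * f a2 b2 <= f (m * a1 + n * a2) (m * b1 + n * b2) + `|n * k - m|%:~R * f a1 b1.
  rewrite -fZ; apply: le_trans (fD _ _ _ _).
  have -> : m * a1 + n * a2 + (n * k - m) * a1 = n * (a2 + k * a1) by ring.
  have -> : m * b1 + n * b2 + (n * k - m) * b1 = n * (b2 + k * b1) by ring.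
  by rewrite fZ gtr0_norm// ler_pM2l ?ltr0z.
have hk' : 2 * `|n * k - m|%:~R <= n%:~R :> R.
  by rewrite -(intrM _ 2) ler_int.
have n2 : 2 <= n%:~R :> R by rewrite (ler_int _ 2); lia.
set N := n%:~R in step hk' n2; set w := `|_|%:~R in step hk'.
have w0 : 0 <= w by rewrite ler0z.
have k1 : w * f a1 b1 <= w * f a2 b2 by exact: ler_wpM2l.
have k2 : 2 * w * f a2 b2 <= N * f a2 b2 by apply: ler_wpM2r => //; exact: ltW.
have k3 : 2 * f a2 b2 <= N * f a2 b2 by apply: ler_wpM2r => //; exact: ltW.
by clear -step k1 k2 k3; lra.
Qed.
End lattice.

(** * Widths and successive minima *)

Section width.
Variable R : realType.
Implicit Types (x y z : 'cV[R]_2) (K : set 'cV[R]_2).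

Lemma col2_0 (a b : R) : col2 a b 0 0 = a. Proof. by rewrite mxE. Qed.
Lemma col2_1 (a b : R) : col2 a b 1 0 = b. Proof. by rewrite mxE. Qed.

Lemma col2_eta x : x = col2 (x 0 0) (x 1 0).
Proof.
apply/matrixP => i j; rewrite !mxE (ord1 j).
by case: i => [[|[|//]] h] /=; congr (x _ _); exact: val_inj.
Qed.

Lemma dotcvE x y : dotcv x y = x 0 0 * y 0 0 + x 1 0 * y 1 0.
Proof.
rewrite /dotcv !big_ord_recl big_ord0 addr0.
by rewrite (_ : lift ord0 ord0 = 1)//; exact: val_inj.
Qed.

Lemma continuous_dotcv z : continuous (fun x => dotcv x z).
Proof.
rewrite (_ : (fun x => _) = (fun x => x 0 0 * z 0 0 + x 1 0 * z 1 0)); last first.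
  by apply/funext => x; exact: dotcvE.
have c (i : 'I_2) : continuous (fun x : 'cV[R]_2 => x i 0) := @coord_continuous _ _ _ i 0.
by move=> x; exact: (cvgD (cvgM (c 0 x) (cvg_cst _)) (cvgM (c 1 x) (cvg_cst _))).
Qed.

Lemma compact_support K z : K !=set0 -> compact K ->
  exists2 x, K x & forall y, K y -> dotcv y z <= dotcv x z.
Proof.
move=> K0 cK.
have [x /set_mem Kx mx] := compact_EVT_max K0 cK (continuous_subspaceT (@continuous_dotcv z)).
by exists x => // y Ky; apply: mx; exact: mem_set.
Qed.

Definition width K z : R := sup [set dotcv (x - y) z | x in K & y in K].

Lemma dotcvBl x y z : dotcv (x - y) z = dotcv x z - dotcv y z.
Proof. by rewrite !dotcvE !mxE; ring. Qed.

Lemma width_eq K z x y : K x -> K y ->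
  (forall x', K x' -> dotcv y z <= dotcv x' z <= dotcv x z) ->
  width K z = dotcv x z - dotcv y z.
Proof.
move=> Kx Ky h; have ub : ubound [set dotcv (x' - y') z | x' in K & y' in K] (dotcv x z - dotcv y z).
  move=> _ [x' Kx' [y' Ky' <-]]; rewrite dotcvBl.
  by have /andP[_ h1] := h _ Kx'; have /andP[h2 _] := h _ Ky'; exact: lerB.
have mem : [set dotcv (x' - y') z | x' in K & y' in K] (dotcv x z - dotcv y z).
  by exists x => //; exists y => //; rewrite dotcvBl.
apply/le_anti/andP; split; first by apply: ge_sup => //; exists (dotcv x z - dotcv y z).
by apply: ub_le_sup => //; exists (dotcv x z - dotcv y z).
Qed.

Section body.
Variable K : set 'cV[R]_2.
Hypothesis hK : convex_body K.

Lemma width_attained z : exists x y, [/\ K x, K y,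
  width K z = dotcv x z - dotcv y z &
  forall x', K x' -> dotcv y z <= dotcv x' z <= dotcv x z].
Proof.
have [cK _ [k0 /interior_subset Kk0]] := hK.
have K0 : K !=set0 by exists k0.
have [x Kx mx] := compact_support z K0 cK.
have [y Ky my] := compact_support (- z) K0 cK.
have h x' : K x' -> dotcv y z <= dotcv x' z <= dotcv x z.
  move=> Kx'; rewrite mx// andbT; have := my _ Kx'; rewrite !dotcvE !mxE; clear; lra.
by exists x, y; split=> //; exact: width_eq.
Qed.

Lemma width_ub x y z : K x -> K y -> dotcv x z - dotcv y z <= width K z.
Proof.
move=> Kx Ky; have [x' [y' [_ _ -> h]]] := width_attained z.
by have /andP[_ h1] := h _ Kx; have /andP[h2 _] := h _ Ky; exact: lerB.
Qed.

(** K contains a cube about an interior point [k0]. The points k0 + u and k0 - u, with the entries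
    of [u] carrying the signs of a and b, already show width at least e (|a| + |b|). *)
Lemma width_coercive : exists2 r : R, 0 < r &
  forall a b : R, r * (`|a| + `|b|) <= width K (col2 a b).
Proof.
have [_ _ [k0]] := hK; rewrite /interior => /nbhs_ballP[e /= e0 eK].
exists e => // a b; pose u := col2 (e / 2 * Num.sg a) (e / 2 * Num.sg b).
have e2 : 0 < e / 2 by rewrite divr_gt0.
have sg1 (c : R) : `|e / 2 * Num.sg c| < e.
  by rewrite normrM gtr0_norm// normr_sg; case: (c != 0); rewrite ?mulr1 ?mulr0 //;
    clear -e0; lra.
have uE i j : `|u i j| < e by rewrite mxE; case: i => [[|[|//]] ?]; exact: sg1.
have K1 : K (k0 + u).
  apply: eK; split=> // i j; rewrite /ball /= !mxE opprD addrA subrr sub0r normrN.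
  by have := uE i j; rewrite mxE.
have K2 : K (k0 - u).
  apply: eK; split=> // i j; rewrite /ball /= !mxE opprD addrA subrr sub0r normrN normrN.
  by have := uE i j; rewrite mxE.
apply: le_trans (width_ub _ K1 K2); rewrite !dotcvE !mxE /=.
by rewrite !normrEsg le_eqVlt; apply/orP; left; apply/eqP; clear; field.
Qed.

Lemma widthZ (k : R) z : width K (k *: z) = `|k| * width K z.
Proof.
have [x [y [Kx Ky -> h]]] := width_attained z.
have dZ x' : dotcv x' (k *: z) = k * dotcv x' z by rewrite !dotcvE !mxE; ring.
have [k0|/ltW k0] := leP 0 k.
  rewrite (@width_eq _ _ x y)//; last first.
    by move=> x' /h /andP[h1 h2]; rewrite !dZ !ler_wpM2l.
  by rewrite !dZ ger0_norm// mulrBr.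
rewrite (@width_eq _ _ y x)//; last first.
  by move=> x' /h /andP[h1 h2]; rewrite !dZ !ler_wnM2l.
by rewrite !dZ ler0_norm// mulNr mulrBr opprB.
Qed.

Lemma widthD z z' : width K (z + z') <= width K z + width K z'.
Proof.
have [x [y [Kx Ky -> _]]] := width_attained (z + z').
have := lerD (width_ub z Kx Ky) (width_ub z' Kx Ky); apply: le_trans.
by rewrite !dotcvE !mxE; clear; lra.
Qed.

(** The gauge of the polar of cs(K) is the support function of cs(K), which is half the width of
    K. *)
Lemma polar_widthP (l : R) z : 0 < l ->
  [set l *: x | x in polar (central_symmetral K)] z <-> width K z / 2 <= l.
Proof.
move=> l0; have ln : l != 0 by rewrite gt_eqF.
split=> [[y yP <-]|h].
  rewrite widthZ gtr0_norm// -mulrA ger_pMr// ler_pdivrMr// mul1r.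
  have [x [x' [Kx Kx' -> _]]] := width_attained y.
  have := yP (2^-1 *: (x - x')); rewrite !dotcvE !mxE.
  have cs : central_symmetral K (2^-1 *: (x - x')) by exists x => //; exists x'.
  by move=> /(_ cs); clear; lra.
exists (l^-1 *: z); last by rewrite scalerA divff// scale1r.
move=> _ [x Kx [y Ky <-]]; have := width_ub z Kx Ky.
have -> : dotcv (2^-1 *: (x - y)) (l^-1 *: z) = (dotcv x z - dotcv y z) / 2 / l.
  by rewrite !dotcvE !mxE; clear -ln; field.
move=> h1; rewrite ler_pdivrMr// mul1r; apply: le_trans h.
by rewrite ler_pM2r// invr_gt0.
Qed.

Definition iwidth (m n : int) : R := width K (col2 m%:~R n%:~R).

Lemma iwidth_reduced_basis : exists a1 b1 a2 b2 : int,
  [/\ a1 * b2 - a2 * b1 = 1,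
    forall m n : int, (m != 0) || (n != 0) -> iwidth a1 b1 <= iwidth m n &
    forall m n : int, n != 0 -> iwidth a2 b2 <= iwidth (m * a1 + n * a2) (m * b1 + n * b2)].
Proof.
have [r r0 hr] := width_coercive.
apply: (@reduced_basis R iwidth r) => //.
- by move=> m n; have := hr m%:~R n%:~R; rewrite !intrD !intr_norm.
- move=> k m n; rewrite /iwidth intr_norm -widthZ; congr width.
  by apply/matrixP => i j; rewrite !mxE; case: i => [[|[|//]] ?] /=; rewrite intrM.
- move=> m n m' n'; rewrite /iwidth; apply: le_trans (widthD _ _).
  rewrite le_eqVlt; apply/orP; left; apply/eqP; congr width.
  by apply/matrixP => i j; rewrite !mxE; case: i => [[|[|//]] ?] /=; rewrite intrD.
Qed.
End body.
End width.

(** * Successive minima read off a reduced basis *)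

Section minima.
Variable R : realType.

Definition ivec (m n : int) : 'cV[int]_2 := \col_(i < 2) [:: m; n]`_i.

Lemma map_ivec (m n : int) :
  map_mx (intr : int -> R) (ivec m n) = col2 m%:~R n%:~R.
Proof. by apply/matrixP => i j; rewrite !mxE; case: i => [[|[|//]] ?]. Qed.

Lemma ivec_eta (z : 'cV[int]_2) : z = ivec (z 0 0) (z 1 0).
Proof.
apply/matrixP => i j; rewrite !mxE (ord1 j).
by case: i => [[|[|//]] h] /=; congr (z _ _); exact: val_inj.
Qed.

Lemma successive_minimum_eq (n i : nat) (L : set 'cV[R]_n) (l : R) :
  lattice_dilates i L l -> lbound (lattice_dilates i L) l ->
  successive_minimum i L = l.
Proof.
move=> Sl lbl; apply: xget_unique; first by split.
by move=> y [Sy lby]; apply/le_anti; rewrite lbl// lby.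
Qed.

Variable K : set 'cV[R]_2.
Hypothesis hK : convex_body K.

(** Two independent lattice vectors cannot both be multiples of z1 = (a1, b1), so one of them has a
    nonzero coordinate along z2 = (a2, b2) and width at least that of z2. Assuming only that the
    determinant squares to 1 admits bases of both orientations. *)
Lemma successive_minima_reduced (a1 b1 a2 b2 : int) :
  (a1 * b2 - a2 * b1) * (a1 * b2 - a2 * b1) = 1 ->
  (forall m n : int, (m != 0) || (n != 0) -> iwidth K a1 b1 <= iwidth K m n) ->
  (forall m n : int, n != 0 ->
     iwidth K a2 b2 <= iwidth K (m * a1 + n * a2) (m * b1 + n * b2)) ->
  successive_minimum 1 (polar (central_symmetral K)) = iwidth K a1 b1 / 2 /\
  successive_minimum 2 (polar (central_symmetral K)) = iwidth K a2 b2 / 2.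
Proof.
move=> dd min1 min2.
set d := a1 * b2 - a2 * b1 in dd.
have d0 : d != 0 by apply/eqP => d0; rewrite d0 mul0r in dd.
have z10 : (a1 != 0) || (b1 != 0).
  apply: contraT; rewrite negb_or !negbK => /andP[/eqP e1 /eqP e2].
  by move: d0; rewrite /d e1 e2 mul0r mulr0 subrr eqxx.
have z20 : (a2 != 0) || (b2 != 0).
  apply: contraT; rewrite negb_or !negbK => /andP[/eqP e1 /eqP e2].
  by move: d0; rewrite /d e1 e2 mul0r mulr0 subrr eqxx.
have [r r0 hr] := width_coercive hK.
have pos m n : (m != 0) || (n != 0) -> 0 < iwidth K m n.
  move=> mn; apply: lt_le_trans (hr _ _); apply: mulr_gt0 => //.
  by case/orP: mn => h; [apply: ltr_wpDr|apply: ltr_wpDl] => //; rewrite normr_gt0 intr_eq0.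
have col2_neq0 (m n : int) : (col2 m%:~R n%:~R : 'cV[R]_2) != 0 -> (m != 0) || (n != 0).
  apply: contraR; rewrite negb_or !negbK => /andP[/eqP -> /eqP ->].
  by apply/eqP/matrixP => i j; rewrite !mxE; case: i => [[|[|//]] ?].
have col2_neq0' (m n : int) : (m != 0) || (n != 0) -> (col2 m%:~R n%:~R : 'cV[R]_2) != 0.
  move=> mn; apply/eqP => /matrixP e; case/orP: mn.
    by have := e 0 0; rewrite !mxE /= => /eqP; rewrite intr_eq0 => ->.
  by have := e 1 0; rewrite !mxE /= => /eqP; rewrite intr_eq0 => ->.
have le12 : iwidth K a1 b1 <= iwidth K a2 b2 by exact: min1.
split; apply: successive_minimum_eq.
- have l0 : 0 < iwidth K a1 b1 / 2 by rewrite divr_gt0 ?pos.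
  split=> //; exists [tuple ivec a1 b1]; split.
    by rewrite /= seq1_free map_ivec; exact: col2_neq0'.
  by move=> j; rewrite (ord1 j) /= map_ivec; apply/polar_widthP.
- move=> l [l0 [z [fz zP]]].
  case: z fz zP => -[|z0 [|//]] //= sz; rewrite seq1_free => fz /(_ 0).
  rewrite (tnth_nth 0) /= => /(polar_widthP hK _ l0); apply: le_trans.
  rewrite (ivec_eta z0) map_ivec in fz *.
  by rewrite ler_pM2r ?invr_gt0//; apply: min1; exact: col2_neq0.
- have l0 : 0 < iwidth K a2 b2 / 2 by rewrite divr_gt0 ?pos.
  split=> //; exists [tuple ivec a1 b1; ivec a2 b2]; split.
    rewrite /= !map_ivec free_cons seq1_free col2_neq0'// andbT span_seq1.
    apply/negP => /vlineP[k] /matrixP e.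
    have := e 0 0; have := e 1 0; rewrite !mxE /= => e1 e2.
    have : d%:~R = 0 :> R.
      by rewrite /d intrB !intrM e1 e2; ring.
    by apply/eqP; rewrite intr_eq0.
  move=> j; rewrite (tnth_nth 0); case: j => [[|[|//]] ?] /=; rewrite map_ivec.
    by apply/(polar_widthP hK _ l0); rewrite ler_pM2r ?invr_gt0.
  by apply/(polar_widthP hK _ l0).
move=> l [l0 [z [fz zP]]].
case: z fz zP => -[|z0 [|z1 [|//]]] //= sz.
rewrite free_cons seq1_free span_seq1 => /andP[nz01 nz1] zP.
have := zP ord_max; have := zP 0; rewrite !(tnth_nth 0) /=.
move=> /(polar_widthP hK _ l0) w0 /(polar_widthP hK _ l0) w1.
rewrite (ivec_eta z0) (ivec_eta z1) !map_ivec in nz01 nz1 w0 w1.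
move: (z0 0 0) (z0 1 0) (z1 0 0) (z1 1 0) nz01 nz1 w0 w1 => x y x' y' nz01 nz1 w0 w1.
(* Cramer's rule for the coordinates in the basis; multiplying by [d] replaces division, as d * d =
   1. *)
have dec (u v : int) : [/\ u = (u * b2 - v * a2) * d * a1 + (a1 * v - b1 * u) * d * a2 &
    v = (u * b2 - v * a2) * d * b1 + (a1 * v - b1 * u) * d * b2].
  split; rewrite -[LHS]mulr1 -dd {1}/d; ring.
have low (u v : int) : width K (col2 u%:~R v%:~R) / 2 <= l ->
    a1 * v - b1 * u != 0 -> iwidth K a2 b2 / 2 <= l.
  move=> h nuv; apply: le_trans h; rewrite ler_pM2r ?invr_gt0//.
  have [eu ev] := dec u v.
  by have := min2 ((u * b2 - v * a2) * d) _ (mulf_neq0 nuv d0); rewrite -eu -ev.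
have [n0|n0] := eqVneq (a1 * y - b1 * x) 0; last exact: low w0 n0.
have [n1|n1] := eqVneq (a1 * y' - b1 * x') 0; last exact: low w1 n1.
(* Both vectors are now integer multiples [m] and [m'] of (a1, b1), contrary to their
   independence. *)
exfalso; have [ex ey] := dec x y; have [ex' ey'] := dec x' y'.
rewrite n0 !mul0r !addr0 in ex ey; rewrite n1 !mul0r !addr0 in ex' ey'.
set m := (x * b2 - y * a2) * d in ex ey; set m' := (x' * b2 - y' * a2) * d in ex' ey'.
clearbody m m'.
have m'0 : m' != 0.
  apply: contraTneq nz1 => m'0; rewrite ex' ey' m'0 !mul0r negbK.
  by apply/eqP/matrixP => i j; rewrite !mxE; case: i => [[|[|//]] ?].
move/negP: nz01; apply; apply/vlineP; exists (m%:~R / m'%:~R).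
have m'R : m'%:~R != 0 :> R by rewrite intr_eq0.
apply/matrixP => i j; rewrite !mxE; case: i => [[|[|//]] ?] /=.
  by rewrite ex ex' !intrM mulrA divfK.
by rewrite ey ey' !intrM mulrA divfK.
Qed.
End minima.

(** * Planar images of convex bodies *)

Section plane.
Variable R : realType.

Definition box (q1 q2 q3 q4 : R) : set (R * R) :=
  [set p | [/\ q1 < p.1, p.1 < q2, q3 < p.2 & p.2 < q4]].

Lemma pmeasurable_box (q1 q2 q3 q4 : R) : pmeasurable (box q1 q2 q3 q4).
Proof.
have := pmeasurableI (pmeasurableI (pmeasurable_halfplane 1 0 (- q1)) (pmeasurable_halfplane (-1) 0 q2))
              (pmeasurableI (pmeasurable_halfplane 0 1 (- q3)) (pmeasurable_halfplane 0 (-1) q4)).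
congr pmeasurable; apply: eq_set => p /=; apply/propext; split.
  by move=> [[h1 h2] [h3 h4]]; split; lra.
by move=> [h1 h2 h3 h4]; split; split; lra.
Qed.

(** An open set is the countable union of the boxes with rational corners that it contains. *)
Lemma pmeasurable_open (U : set (R * R)) :
  (forall p, U p -> exists2 e, 0 < e &
    forall p', `|p'.1 - p.1| < e -> `|p'.2 - p.2| < e -> U p') -> pmeasurable U.
Proof.
move=> oU.
(* [F] is empty when its box is not contained in U, so the union can run over all rational
   quadruples. *)
pose F q1 q2 q3 q4 : set (R * R) := [set p | box (ratr q1) (ratr q2) (ratr q3) (ratr q4) p /\
  box (ratr q1) (ratr q2) (ratr q3) (ratr q4) `<=` U].
have -> : U = \bigcup_q1 \bigcup_q2 \bigcup_q3 \bigcup_q4 F q1 q2 q3 q4.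
  apply/seteqP; split=> [p Up|p [q1 _ [q2 _ [q3 _ [q4 _ [h1 h2]]]]]]; last exact: h2.
  have [e e0 he] := oU p Up.
  have rat_lt (x y : R) : x < y -> exists q : rat, x < ratr q < y.
    by move=> /rat_in_itvoo[q]; rewrite in_itv /=; exists q.
  have [q1 /andP[k1 k1']] : exists q : rat, p.1 - e < ratr q < p.1 by apply: rat_lt; lra.
  have [q2 /andP[k2 k2']] : exists q : rat, p.1 < ratr q < p.1 + e by apply: rat_lt; lra.
  have [q3 /andP[k3 k3']] : exists q : rat, p.2 - e < ratr q < p.2 by apply: rat_lt; lra.
  have [q4 /andP[k4 k4']] : exists q : rat, p.2 < ratr q < p.2 + e by apply: rat_lt; lra.
  exists q1 => //; exists q2 => //; exists q3 => //; exists q4 => //; split=> //.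
  move=> p' [h1 h2 h3 h4].
  by apply: he; rewrite ltr_distl; apply/andP; split; lra.
do 4! (apply: bigcupT_measurable_rat => ?).
rewrite /F; set B := box _ _ _ _; have [BU|BU] := pselect (B `<=` U).
  rewrite (_ : [set _ | _] = B); first exact: pmeasurable_box.
  by apply/seteqP; split=> p; [case|].
by rewrite (_ : [set _ | _] = set0)//; apply/seteqP; split=> p // [].
Qed.

Definition plane (K : set 'cV[R]_2) : set (R * R) := [set p | K (col2 p.1 p.2)].

Lemma pmeasurable_plane (K : set 'cV[R]_2) : compact K -> pmeasurable (plane K).
Proof.
move=> cK; have clK : closed K by apply: compact_closed => //; exact: norm_hausdorff.
rewrite -[plane K]setCK; apply: pmeasurableC; apply: pmeasurable_open => p nKp.
have : nbhs (col2 p.1 p.2) (~` K).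
  by apply: open_nbhs_nbhs; split; [exact: closed_openC|].
move=> /nbhs_ballP[e /= e0 eK]; exists e => // p' h1 h2.
apply: eK; split=> // i j; rewrite /ball /= !mxE.
by case: i => [[|[|//]] ?] /=; rewrite distrC.
Qed.

Lemma pconvex_plane (K : set 'cV[R]_2) : convex_set K -> pconvex (plane K).
Proof.
move=> cK P Q l KP KQ l0 l1.
have := cK (col2 P.1 P.2) (col2 Q.1 Q.2) (Itv01 l0 l1) (mem_set KP) (mem_set KQ).
move=> /set_mem; congr K.
by apply/matrixP => i j; rewrite !mxE; case: i => [[|[|//]] ?].
Qed.

Lemma convex_plane (S : set (R * R)) : pconvex S ->
  convex_set [set x : 'cV[R]_2 | S (x 0 0, x 1 0)].
Proof.
move=> cS x y l /set_mem xS /set_mem yS; apply: mem_set.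
have l0 : 0 <= l%:num by [].
have l1 : l%:num <= 1 by [].
have := cS _ _ l%:num xS yS l0 l1; rewrite /=.
by congr S; congr pair; rewrite !mxE.
Qed.

Lemma cross_conv (P Q G H : R * R) (l : R) :
  cross P Q (l * G.1 + (1 - l) * H.1, l * G.2 + (1 - l) * H.2) =
  l * cross P Q G + (1 - l) * cross P Q H.
Proof. by rewrite /cross /=; ring. Qed.

Lemma pconvex_closed_triangle (P Q T : R * R) : pconvex (closed_triangle P Q T).
Proof.
move=> G H l [g1 g2 g3] [h1 h2 h3] l0 l1.
have l1' : 0 <= 1 - l by rewrite subr_ge0.
by split; rewrite cross_conv; apply: addr_ge0; apply: mulr_ge0.
Qed.

Lemma closed_triangle_vertices (P Q T : R * R) : 0 <= cross P Q T ->
  [/\ closed_triangle P Q T P, closed_triangle P Q T Q & closed_triangle P Q T T].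
Proof.
have e1 : cross Q T P = cross P Q T by rewrite /cross; ring.
have e2 : cross T P Q = cross P Q T by rewrite /cross; ring.
by move=> D0; split; split; rewrite ?cross_degenl ?cross_degenr ?e1 ?e2.
Qed.

Lemma cross_std (s t : R) : cross (left_vertex s t) (bottom_vertex t) (right_vertex s t) = s * s + 2 * s * (2 * t - s).
Proof. by rewrite /cross /left_vertex /right_vertex /bottom_vertex /=; ring. Qed.

Lemma cross_std_gt0 (s t : R) : 0 < s -> s <= t ->
  0 < cross (left_vertex s t) (bottom_vertex t) (right_vertex s t).
Proof.
by move=> s0 st; rewrite cross_std; apply: addr_gt0; apply: mulr_gt0; lra.
Qed.

Lemma triangle_vertices (s t : R) : [/\ triangle s t (col2 (- s) (t - s)),
  triangle s t (col2 s t) & triangle s t (col2 0 (- t))].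
Proof.
by split; apply: sub_gen_smallest; [left|right; left|right; right].
Qed.

Lemma triangleE (s t : R) : 0 < s -> s <= t ->
  triangle s t = [set x | std_triangle s t (x 0 0, x 1 0)].
Proof.
move=> s0 st; apply/seteqP; split.
  apply: smallest_sub; first exact/convex_plane/pconvex_closed_triangle.
  have [hA hC hB] := closed_triangle_vertices (ltW (cross_std_gt0 s0 st)).
  by move=> x [->|[->|->]]; rewrite /= !mxE.
move=> x xT C [cC VC].
have := @closed_triangle_sub R (plane C) (left_vertex s t) (bottom_vertex t) (right_vertex s t) (pconvex_plane cC).
have VA : plane C (left_vertex s t) by apply: VC; left.
have VB : plane C (right_vertex s t) by apply: VC; right; left.
have VD : plane C (bottom_vertex t) by apply: VC; right; right.
by move=> /(_ VA VD VB (cross_std_gt0 s0 st) _ xT); rewrite /plane /= -col2_eta.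
Qed.

(** The box is convex and contains the three vertices. This bounds the coordinate widths of the
    triangle from above. *)
Lemma triangle_box (s t : R) (x : 'cV[R]_2) : 0 < s -> s <= t -> triangle s t x ->
  - s <= x 0 0 <= s /\ - t <= x 1 0 <= t.
Proof.
move=> s0 st; suff h : triangle s t `<=`
    [set x | - s <= x 0 0 <= s /\ - t <= x 1 0 <= t] by exact: h.
apply: smallest_sub.
  move=> {}x y l /set_mem [/andP[x1 x2] /andP[x3 x4]] /set_mem [/andP[y1 y2] /andP[y3 y4]].
  apply: mem_set; rewrite /=.
  have E i : (conv l x y : 'cV[R]_2) i 0 = l%:num * x i 0 + (1 - l%:num) * y i 0.
    by rewrite !mxE.
  rewrite !E {E}.
  have l0 : 0 <= l%:num by [].
  have l1 : 0 <= 1 - l%:num by rewrite subr_ge0.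
  have := (ler_wpM2l l0 x1, ler_wpM2l l0 x2, ler_wpM2l l0 x3, ler_wpM2l l0 x4).
  have := (ler_wpM2l l1 y1, ler_wpM2l l1 y2, ler_wpM2l l1 y3, ler_wpM2l l1 y4).
  move=> -[[[]]] k1 k2 k3 k4 [[[]]] k5 k6 k7 k8.
  by split; apply/andP; split; clear -k1 k2 k3 k4 k5 k6 k7 k8; lra.
by move=> _ [->|[->|->]]; rewrite /= !mxE /=; split; apply/andP; split; lra.
Qed.
End plane.

(** * The inequality, and the triangles forced by equality *)

Section main.
Variable R : realType.

Definition mx2 (T : Type) (a b c d : T) : 'M[T]_2 :=
  \matrix_(i, j) (if i == 0 then if j == 0 then a else b else if j == 0 then c else d).

Lemma mx2_mulE (A : 'M[R]_2) (x : 'cV[R]_2) (i : 'I_2) :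
  (A *m x) i 0 = A i 0 * x 0 0 + A i 1 * x 1 0.
Proof.
rewrite mxE !big_ord_recl big_ord0 addr0.
by rewrite (_ : lift ord0 ord0 = 1)//; exact: val_inj.
Qed.

Lemma mx2_mul (A B : 'M[int]_2) (i j : 'I_2) :
  (A *m B) i j = A i 0 * B 0 j + A i 1 * B 1 j.
Proof.
rewrite mxE !big_ord_recl big_ord0 addr0.
by rewrite (_ : lift ord0 ord0 = 1)//; exact: val_inj.
Qed.

Lemma col2_inj (x y : 'cV[R]_2) : x 0 0 = y 0 0 -> x 1 0 = y 1 0 -> x = y.
Proof. by move=> e1 e2; rewrite [x]col2_eta [y]col2_eta e1 e2. Qed.

(** In the coordinates given by a reduced basis and centred in the box, K becomes a set [S] of the
    same area to which [planar_bound] applies, with s and t the two successive minima. *)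
Lemma area_bound_width (K : set 'cV[R]_2) : convex_body K ->
  let l1 := successive_minimum 1 (polar (central_symmetral K)) in
  let l2 := successive_minimum 2 (polar (central_symmetral K)) in
  ((2 * l1 * l2 - l1 ^+ 2 / 2)%:E <= vol2 K)%E /\
  (vol2 K = (2 * l1 * l2 - l1 ^+ 2 / 2)%:E ->
   exists s t : R, [/\ 0 < s, s <= t & unimodular_translate K (triangle s t)]).
Proof.
move=> hK; have [cK convK _] := hK.
have [a1 [b1 [a2 [b2 [det min1 min2]]]]] := iwidth_reduced_basis hK.
have detR : a1%:~R * b2%:~R - a2%:~R * b1%:~R = 1 :> R.
  by rewrite -!intrM -intrB det.
have [] := successive_minima_reduced hK (a1 := a1) (b1 := b1) (a2 := a2) (b2 := b2) => //.
  by rewrite det.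
move=> -> -> /=.
pose za : 'cV[R]_2 := col2 a1%:~R b1%:~R; pose zb : 'cV[R]_2 := col2 a2%:~R b2%:~R.
have [xB [xA [KB KA wAB hAB]]] := width_attained hK za.
have [xD [xC [KD KC wCD hCD]]] := width_attained hK zb.
have [xE [xF [KE KF wEF hEF]]] := width_attained hK (za - zb).
have [xE' [xF' [KE' KF' wEF' hEF']]] := width_attained hK (za + zb).
have w12 : iwidth K a1 b1 <= iwidth K a2 b2.
  apply: min1; apply: contraT; rewrite negb_or !negbK => /andP[/eqP e1 /eqP e2].
  by move: det; rewrite e1 e2 mulr0 mul0r subrr.
have w1_gt0 : 0 < iwidth K a1 b1.
  have [r r0 hr] := width_coercive hK; apply: lt_le_trans (hr _ _); apply: mulr_gt0 => //.
  rewrite lt_neqAle addr_ge0// andbT eq_sym paddr_eq0// !normr_eq0 !intr_eq0.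
  by apply/negP => /andP[/eqP e1 /eqP e2]; move: det; rewrite e1 e2 mulr0 mul0r subrr.
(* The vectors z1 - z2 and z1 + z2 have a nonzero coordinate along z2, so they are at least as wide
   as z2; these are the two diagonal width conditions. *)
have wm : iwidth K a2 b2 <= width K (za - zb).
  have := min2 1 (-1) isT; congr (is_true (_ <= width K _)).
  by apply: col2_inj; rewrite !mxE /= !mul1r !mulN1r intrB.
have wp : iwidth K a2 b2 <= width K (za + zb).
  have := min2 1 1 isT; congr (is_true (_ <= width K _)).
  by apply: col2_inj; rewrite !mxE /= !mul1r intrD.
rewrite [iwidth K a1 b1]wAB [iwidth K a2 b2]wCD in w12 w1_gt0 wm wp *.
rewrite wEF in wm; rewrite wEF' in wp.
have dB (k : 'cV[R]_2) : dotcv k (za - zb) = dotcv k za - dotcv k zb.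
  by rewrite !dotcvE !mxE; ring.
have dD (k : 'cV[R]_2) : dotcv k (za + zb) = dotcv k za + dotcv k zb.
  by rewrite !dotcvE !mxE; ring.
rewrite !dB in wm; rewrite !dD in wp.
set s := (_ - _) / 2; set t := (dotcv xD zb - _) / 2.
(* Subtracting the midpoints [mx] and [my] centres the box at the origin. The pair [k0], [k1]
   inverts [u], [v], with integer linear part because the basis has determinant 1. *)
pose mx := (dotcv xB za + dotcv xA za) / 2; pose my := (dotcv xD zb + dotcv xC zb) / 2.
pose u (k : 'cV[R]_2) := dotcv k za - mx; pose v (k : 'cV[R]_2) := dotcv k zb - my.
pose k0 (G : R * R) := b2%:~R * G.1 + (- b1%:~R) * G.2 + (b2%:~R * mx - b1%:~R * my).
pose k1 (G : R * R) := (- a2%:~R) * G.1 + a1%:~R * G.2 + (a1%:~R * my - a2%:~R * mx).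
pose S := [set G | plane K (k0 G, k1 G)].
have uvK k : col2 (k0 (u k, v k)) (k1 (u k, v k)) = k.
  rewrite /k0 /k1 /u /v /za /zb; clearbody mx my.
  apply: col2_inj; rewrite !mxE /= !dotcvE !mxE /=.
    transitivity ((a1%:~R * b2%:~R - a2%:~R * b1%:~R) * k 0 0); first by ring.
    by rewrite detR mul1r.
  transitivity ((a1%:~R * b2%:~R - a2%:~R * b1%:~R) * k 1 0); first by ring.
  by rewrite detR mul1r.
have Kuv G : u (col2 (k0 G) (k1 G)) = G.1 /\ v (col2 (k0 G) (k1 G)) = G.2.
  rewrite /k0 /k1 /u /v /za /zb; clearbody mx my.
  rewrite !dotcvE !mxE /=; split.
    transitivity ((a1%:~R * b2%:~R - a2%:~R * b1%:~R) * (G.1 + mx) - mx); first by ring.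
    by rewrite detR mul1r addrK.
  transitivity ((a1%:~R * b2%:~R - a2%:~R * b1%:~R) * (G.2 + my) - my); first by ring.
  by rewrite detR mul1r addrK.
have SK k : K k -> S (u k, v k).
  by move=> Kk; rewrite /S /= /plane /= uvK.
have KS G : S G -> exists2 k, K k & G = (u k, v k).
  move=> SG; exists (col2 (k0 G) (k1 G)) => //.
  by have [-> ->] := Kuv G; case: G {SG}.
have mK := pmeasurable_plane cK.
have mS : pmeasurable S by exact: pmeasurable_affine.
have aS : area S = vol2 K.
  have D1 : b2%:~R * a1%:~R - (- b1%:~R) * (- a2%:~R) = 1 :> R.
    by rewrite mulrNN mulrC [b1%:~R * _]mulrC.
  have := area_affine (b2%:~R * mx - b1%:~R * my) (a1%:~R * my - a2%:~R * mx) _ mK.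
  move=> /(_ b2%:~R (- b1%:~R) (- a2%:~R) a1%:~R).
  by rewrite D1 normr1 mul1e oner_neq0 => /(_ isT).
have cS : pconvex S.
  move=> P Q l SP SQ l0 l1; have := pconvex_plane convK SP SQ l0 l1.
  by congr (plane K (_, _)); rewrite /k0 /k1 /=; ring.
have hs : 0 < s by rewrite divr_gt0.
have st : s <= t by rewrite ler_pM2r ?invr_gt0.
have box G : S G -> [/\ - s <= G.1, G.1 <= s, - t <= G.2 & G.2 <= t].
  move=> /KS[k Kk ->] /=; have /andP[h1 h2] := hAB _ Kk; have /andP[h3 h4] := hCD _ Kk.
  by rewrite /s /t /u /v /mx /my; clear -h1 h2 h3 h4; split; lra.
have uA : u xA = - s by rewrite /u /mx /s; clear; field.
have uB : u xB = s by rewrite /u /mx /s; clear; field.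
have vC : v xC = - t by rewrite /v /my /t; clear; field.
have vD : v xD = t by rewrite /v /my /t; clear; field.
have SA : S (- s, v xA) by rewrite -uA; exact: SK.
have SB : S (s, v xB) by rewrite -uB; exact: SK.
have SC : S (u xC, - t) by rewrite -vC; exact: SK.
have SD : S (u xD, t) by rewrite -vD; exact: SK.
have [||||h1 h2] := planar_bound hs st cS mS box SA SB SC SD (SK _ KE) (SK _ KF) _ _ (SK _ KE') (SK _ KF').
- move=> G /KS[k Kk ->] /=; have := hEF _ Kk; rewrite !dB => /andP[q1 q2].
  by rewrite /u /v; clear -q1 q2; apply/andP; split; lra.
- by rewrite /u /v /t; clear -wm; lra.
- move=> G /KS[k Kk ->] /=; have := hEF' _ Kk; rewrite !dD => /andP[q1 q2].
  by rewrite /u /v; clear -q1 q2; apply/andP; split; lra.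
- by rewrite /u /v /t; clear -wp; lra.
rewrite aS in h1 h2; split=> // /h2[x [y SE]].
exists s, t; split=> //.
have sgR (c : bool) : ((-1) ^+ c)%:~R = (-1) ^+ c :> R by rewrite rmorphXn.
pose ex : int := (-1) ^+ x; pose ey : int := (-1) ^+ y.
have exx : ex * ex = 1 by rewrite /ex -expr2 sqrr_sign.
have eyy : ey * ey = 1 by rewrite /ey -expr2 sqrr_sign.
have exxR : ex%:~R * ex%:~R = 1 :> R by rewrite -intrM exx.
have eyyR : ey%:~R * ey%:~R = 1 :> R by rewrite -intrM eyy.
(* [U] is the inverse of the matrix with rows z1 and z2, multiplied by the diagonal sign matrix from
   the equality case. *)
pose U := mx2 (b2 * ex) (- b1 * ey) (- a2 * ex) (a1 * ey).
pose w : 'cV[R]_2 := col2 (b2%:~R * mx - b1%:~R * my) (a1%:~R * my - a2%:~R * mx).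
exists U, w; split.
  have : mx2 (ex * a1) (ex * b1) (ey * a2) (ey * b2) *m U = 1%:M.
    apply/matrixP => i j; rewrite mx2_mul !mxE /=.
    case: i => [[|[|//]] ?]; case: j => [[|[|//]] ?] /=.
    - by transitivity (ex * ex * (a1 * b2 - a2 * b1)); [ring|rewrite exx det].
    - by ring.
    - by ring.
    - by transitivity (ey * ey * (a1 * b2 - a2 * b1)); [ring|rewrite eyy det].
  by move/mulmx1_unit => [].
have Uw (G : 'cV[R]_2) : map_mx intr U *m G + w =
    col2 (k0 (ex%:~R * G 0 0, ey%:~R * G 1 0)) (k1 (ex%:~R * G 0 0, ey%:~R * G 1 0)).
  apply: col2_inj; rewrite mxE mx2_mulE !mxE /k0 /k1 /= !(intrM, mulrNz); ring.
have SE' G : S G <-> std_triangle s t (ex%:~R * G.1, ey%:~R * G.2).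
  by rewrite SE /= /ex /ey !sgR.
rewrite triangleE//; apply/seteqP; split=> [k Kk|_ [x' Tx' <-]].
  have /SE' /= T := SK _ Kk.
  exists (col2 (ex%:~R * u k) (ey%:~R * v k)); first by rewrite /= col2_0 col2_1.
  by rewrite Uw col2_0 col2_1 !mulrA exxR eyyR !mul1r uvK.
rewrite Uw; have /= : S (ex%:~R * x' 0 0, ey%:~R * x' 1 0).
  by apply/SE'; rewrite /= !mulrA exxR eyyR !mul1r.
by [].
Qed.
End main.

(** * The triangles attain equality *)

Section converse.
Variable R : realType.

Lemma intr_ge1 (n : int) : 0 < n -> 1 <= n%:~R :> R.
Proof. by rewrite (ler_int _ 1). Qed.

Lemma intr_leN1 (n : int) : n < 0 -> n%:~R <= -1 :> R.
Proof. by move=> n0; rewrite -(intrN _ 1) ler_int; lia. Qed.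

(** The rows of the inverse of U form a reduced basis for K, with widths 2s and 2t. The remaining
    lattice directions are bounded below by differences of vertices, and the area is carried over
    from the triangle because U has determinant 1 or -1. *)
Lemma triangle_minima_area (K : set 'cV[R]_2) (s t : R) : convex_body K ->
  0 < s -> s <= t -> unimodular_translate K (triangle s t) ->
  [/\ successive_minimum 1 (polar (central_symmetral K)) = s,
      successive_minimum 2 (polar (central_symmetral K)) = t &
      vol2 K = (2 * s * t - s ^+ 2 / 2)%:E].
Proof.
move=> hK s0 st [U [v [uU KE]]].
have [cK _ _] := hK.
pose V := invmx U.
have ent (A B : 'M[int]_2) : A *m B = 1%:M ->
  [/\ A 0 0 * B 0 0 + A 0 1 * B 1 0 = 1, A 0 0 * B 0 1 + A 0 1 * B 1 1 = 0,
      A 1 0 * B 0 0 + A 1 1 * B 1 0 = 0 & A 1 0 * B 0 1 + A 1 1 * B 1 1 = 1].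
  move=> /matrixP AB; have := (AB 0 0, AB 0 1, AB 1 0, AB 1 1).
  by rewrite !mx2_mul !mxE /= => -[[[]]] -> -> -> ->.
have [uv00 uv01 uv10 uv11] := ent _ _ (mulmxV uU).
have [vu00 vu01 vu10 vu11] := ent _ _ (mulVmx uU).
rewrite -/V in uv00 uv01 uv10 uv11 vu00 vu01 vu10 vu11.
pose a1 := V 0 0; pose b1 := V 0 1; pose a2 := V 1 0; pose b2 := V 1 1.
rewrite -/a1 -/b1 -/a2 -/b2 in uv00 uv01 uv10 uv11 vu00 vu01 vu10 vu11.
pose d := a1 * b2 - a2 * b1.
have dd : d * d = 1.
  have du : (U 0 0 * U 1 1 - U 0 1 * U 1 0) * d = 1.
    transitivity ((U 0 0 * a1 + U 0 1 * a2) * (U 1 0 * b1 + U 1 1 * b2) -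
      (U 0 0 * b1 + U 0 1 * b2) * (U 1 0 * a1 + U 1 1 * a2)); first by rewrite /d; ring.
    by rewrite uv00 uv01 uv10 uv11 mulr1 mulr0 subr0.
  move/(congr1 absz)/eqP: du; rewrite abszM muln_eq1 => /andP[_ /eqP d1].
  have [-> | ->] : d = 1 \/ d = -1 by lia.
    by [].
  by [].
(* The width of K along (p, q) is that of the triangle along the image (m, n) of (p, q) under the
   transpose of U. *)
have dotU (x : 'cV[R]_2) (p q : int) : dotcv (map_mx intr U *m x + v) (col2 p%:~R q%:~R) =
    (U 0 0 * p + U 1 0 * q)%:~R * x 0 0 + (U 0 1 * p + U 1 1 * q)%:~R * x 1 0 +
    dotcv v (col2 p%:~R q%:~R).
  by rewrite !dotcvE ![(_ + v) _ _]mxE !mx2_mulE ![map_mx _ _ _ _]mxE !col2_0 !col2_1 !intrD !intrM; ring.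
have KT x : triangle s t x -> K (map_mx intr U *m x + v) by move=> Tx; rewrite KE; exists x.
have [TA TB TC] := triangle_vertices s t.
have low (p q : int) (x y : 'cV[R]_2) : triangle s t x -> triangle s t y ->
  (U 0 0 * p + U 1 0 * q)%:~R * (x 0 0 - y 0 0) + (U 0 1 * p + U 1 1 * q)%:~R * (x 1 0 - y 1 0)
    <= iwidth K p q.
  move=> Tx Ty; have := width_ub hK (col2 p%:~R q%:~R) (KT _ Tx) (KT _ Ty).
  by rewrite !dotU; apply: le_trans; clear; lra.
have low1 (p q : int) : U 0 1 * p + U 1 1 * q = 0 -> U 0 0 * p + U 1 0 * q != 0 ->
    2 * s <= iwidth K p q.
  move=> n0 m0; have h1 := low p q _ _ TB TA; have h2 := low p q _ _ TA TB.
  rewrite n0 !col2_0 !col2_1 !mul0r !addr0 in h1 h2.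
  move: (U 0 0 * p + U 1 0 * q) m0 h1 h2 => m m0 h1 h2.
  have [mn|mp|m0'] := ltgtP m 0; last by rewrite m0' eqxx in m0.
    have k : m%:~R <= -1 :> R by exact: intr_leN1.
    by have := ler_wpM2r (ltW s0) k; clear -h2; lra.
  have k : 1 <= m%:~R :> R by exact: intr_ge1.
  by have := ler_wpM2r (ltW s0) k; clear -h1; lra.
(* When m n >= 0 the edge vector (s, 2t) gives |m| s + 2t |n| >= 2t; for opposite signs the edge
   vector (-s, 2t - s) gives |m| s + (2t - s) |n| >= 2t. *)
have low2 (p q : int) : U 0 1 * p + U 1 1 * q != 0 -> 2 * t <= iwidth K p q.
  move=> n0.
  have h1 := low p q _ _ TB TC; have h2 := low p q _ _ TC TB.
  have h3 := low p q _ _ TA TC; have h4 := low p q _ _ TC TA.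
  rewrite !col2_0 !col2_1 in h1 h2 h3 h4.
  move: (U 0 0 * p + U 1 0 * q) (U 0 1 * p + U 1 1 * q) n0 h1 h2 h3 h4 => m n n0 h1 h2 h3 h4.
  have t0 : 0 < t by apply: lt_le_trans st.
  have ts : 0 <= 2 * t - s by clear -s0 st; lra.
  have t2 : 0 <= 2 * t by clear -t0; lra.
  have [np|nn|n0'] := ltgtP n 0; last by rewrite n0' eqxx in n0.
    have k : n%:~R <= -1 :> R by exact: intr_leN1.
    have [mp|mn] := leP m 0.
      have k' : m%:~R <= 0 :> R by rewrite (ler_int _ _ 0).
      have g1 := mulr_le0_ge0 k' (ltW s0); have g2 := ler_wpM2r t2 k.
      by clear -h2 g1 g2; lra.
    have k' : 1 <= m%:~R :> R by exact: intr_ge1.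
    have g1 := ler_wpM2r (ltW s0) k'; have g2 := ler_wpM2r ts k.
    by clear -h4 g1 g2; lra.
  have k : 1 <= n%:~R :> R by exact: intr_ge1.
  have [mp|mn] := leP 0 m.
    have k' : 0 <= m%:~R :> R by rewrite (ler_int _ 0).
    have g1 := mulr_ge0 k' (ltW s0); have g2 := ler_wpM2r t2 k.
    by clear -h1 g1 g2; lra.
  have k' : m%:~R <= -1 :> R by exact: intr_leN1.
  have g1 := ler_wpM2r (ltW s0) k'; have g2 := ler_wpM2r ts k.
  by clear -h3 g1 g2; lra.
have w1 : iwidth K a1 b1 = 2 * s.
  rewrite /iwidth (width_eq (KT _ TB) (KT _ TA)).
    by rewrite !dotU !col2_0 !col2_1 [U 0 0 * _]mulrC [U 1 0 * _]mulrC [U 0 1 * _]mulrC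
      [U 1 1 * _]mulrC vu00 vu01; clear; ring.
  rewrite KE => _ [x Tx <-]; have [/andP[q1 q2] _] := triangle_box s0 st Tx.
  rewrite !dotU !col2_0 !col2_1 [U 0 0 * _]mulrC [U 1 0 * _]mulrC [U 0 1 * _]mulrC
      [U 1 1 * _]mulrC vu00 vu01 !mul1r !mul0r !addr0.
  by apply/andP; split; rewrite lerD2r.
have w2 : iwidth K a2 b2 = 2 * t.
  rewrite /iwidth (width_eq (KT _ TB) (KT _ TC)).
    by rewrite !dotU !col2_0 !col2_1 [U 0 0 * _]mulrC [U 1 0 * _]mulrC [U 0 1 * _]mulrC
      [U 1 1 * _]mulrC vu10 vu11; clear; ring.
  rewrite KE => _ [x Tx <-]; have [_ /andP[q1 q2]] := triangle_box s0 st Tx.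
  rewrite !dotU !col2_0 !col2_1 [U 0 0 * _]mulrC [U 1 0 * _]mulrC [U 0 1 * _]mulrC
      [U 1 1 * _]mulrC vu10 vu11 !mul1r !mul0r !add0r.
  by apply/andP; split; rewrite lerD2r.
have [] := successive_minima_reduced hK dd.
- move=> p q pq; rewrite w1.
  have [n0|n0] := eqVneq (U 0 1 * p + U 1 1 * q) 0.
    apply: low1 => //; apply/eqP => m0.
    have p0 : p = 0.
      transitivity (a1 * (U 0 0 * p + U 1 0 * q) + a2 * (U 0 1 * p + U 1 1 * q)).
        transitivity ((U 0 0 * a1 + U 0 1 * a2) * p + (U 1 0 * a1 + U 1 1 * a2) * q);
          last by ring.
        by rewrite uv00 uv10; ring.
      by rewrite m0 n0 !mulr0.
    have q0 : q = 0.
      transitivity (b1 * (U 0 0 * p + U 1 0 * q) + b2 * (U 0 1 * p + U 1 1 * q)).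
        transitivity ((U 0 0 * b1 + U 0 1 * b2) * p + (U 1 0 * b1 + U 1 1 * b2) * q);
          last by ring.
        by rewrite uv01 uv11; ring.
      by rewrite m0 n0 !mulr0.
    by rewrite p0 q0 in pq.
  by apply: le_trans (low2 _ _ n0); rewrite ler_pM2l.
- move=> m n n0; rewrite w2; apply: low2.
  rewrite (_ : _ + _ = m * (a1 * U 0 1 + b1 * U 1 1) + n * (a2 * U 0 1 + b2 * U 1 1));
    last by ring.
  by rewrite vu01 vu11 mulr0 add0r mulr1.
rewrite w1 w2 => -> ->.
split; [by field|by field|].
have D1 : `|a1%:~R * b2%:~R - b1%:~R * a2%:~R| = 1 :> R.
  have : d%:~R ^+ 2 = 1 :> R by rewrite expr2 -intrM dd.
  rewrite /d intrB !intrM [a2%:~R * _]mulrC => h.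
  by apply/eqP; rewrite -sqrp_eq1 ?normr_ge0// -normrX h normr1.
have D0 : a1%:~R * b2%:~R - b1%:~R * a2%:~R != 0 :> R.
  by rewrite -normr_eq0 D1 oner_neq0.
(* The inverse motion, with linear part [V], pulls the triangle back to K and has determinant of
   absolute value 1. *)
have := area_affine (- (a1%:~R * v 0 0 + b1%:~R * v 1 0)) (- (a2%:~R * v 0 0 + b2%:~R * v 1 0)) D0
  (pmeasurable_closed_triangle (left_vertex s t) (bottom_vertex t)
    (right_vertex s t)).
rewrite D1 mul1e area_closed_triangle ?cross_std_gt0// cross_std => aK.
have -> : 2 * s * t - s ^+ 2 / 2 = (s * s + 2 * s * (2 * t - s)) / 2 by field.
rewrite -aK -[vol2 K]/(area (plane K)); congr area; apply: eq_set => -[X Y] /=; apply/propext.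
have inv (x y : R) :
  (a1%:~R * ((U 0 0)%:~R * x + (U 0 1)%:~R * y + v 0 0) + b1%:~R * ((U 1 0)%:~R * x + (U 1 1)%:~R * y + v 1 0)
    + - (a1%:~R * v 0 0 + b1%:~R * v 1 0) = x) /\
  (a2%:~R * ((U 0 0)%:~R * x + (U 0 1)%:~R * y + v 0 0) + b2%:~R * ((U 1 0)%:~R * x + (U 1 1)%:~R * y + v 1 0)
    + - (a2%:~R * v 0 0 + b2%:~R * v 1 0) = y).
  split.
    transitivity ((a1 * U 0 0 + b1 * U 1 0)%:~R * x + (a1 * U 0 1 + b1 * U 1 1)%:~R * y).
      by rewrite !intrD !intrM; ring.
    by rewrite vu00 vu01 mul1r mul0r addr0.
  transitivity ((a2 * U 0 0 + b2 * U 1 0)%:~R * x + (a2 * U 0 1 + b2 * U 1 1)%:~R * y).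
    by rewrite !intrD !intrM; ring.
  by rewrite vu10 vu11 mul1r mul0r add0r.
rewrite KE /plane /=; split.
  move=> [x Tx /matrixP e]; have e0 := e 0 0; have e1 := e 1 0.
  rewrite [(_ + v) _ _]mxE mx2_mulE ![map_mx _ _ _ _]mxE col2_0 in e0.
  rewrite [(_ + v) _ _]mxE mx2_mulE ![map_mx _ _ _ _]mxE col2_1 in e1.
  rewrite -e0 -e1; have [-> ->] := inv (x 0 0) (x 1 0).
  by move: Tx; rewrite triangleE.
move=> T; set x := a1%:~R * X + _ + _ in T; set y := a2%:~R * X + _ + _ in T.
exists (col2 x y); first by rewrite triangleE//= col2_0 col2_1.
apply: col2_inj; rewrite [(_ + v) _ _]mxE mx2_mulE ![map_mx _ _ _ _]mxE ?col2_0 ?col2_1 /x /y.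
  transitivity ((U 0 0 * a1 + U 0 1 * a2)%:~R * (X - v 0 0) + (U 0 0 * b1 + U 0 1 * b2)%:~R * (Y - v 1 0) + v 0 0).
    by rewrite !intrD !intrM; ring.
  by rewrite uv00 uv01; ring.
transitivity ((U 1 0 * a1 + U 1 1 * a2)%:~R * (X - v 0 0) + (U 1 0 * b1 + U 1 1 * b2)%:~R * (Y - v 1 0) + v 1 0).
  by rewrite !intrD !intrM; ring.
by rewrite uv10 uv11; ring.
Qed.
End converse.

Theorem theorem1p1 (R : realType) (K : set 'cV[R]_2) (hK : convex_body K) :
  let l1 := successive_minimum 1 (polar (central_symmetral K)) in
  let l2 := successive_minimum 2 (polar (central_symmetral K)) in
  let b := 3 / 2 * l1 * l2 + 1 / 2 * l1 * (l2 - l1) in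
  (b%:E <= vol2 K)%E /\
  (vol2 K = b%:E <->
   exists s t : R, [/\ 0 < s, s <= t & unimodular_translate K (triangle s t)]).
Proof.
move=> l1 l2 b; have bE : b = 2 * l1 * l2 - l1 ^+ 2 / 2 by rewrite /b; field.
have [le_vol eq_vol] := area_bound_width hK.
rewrite bE; split=> //; split=> // -[s [t [s0 st Ktri]]].
have [l1E l2E ->] := triangle_minima_area hK s0 st Ktri.
by rewrite /l1 /l2 l1E l2E.
Qed.
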